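(* Let $f:\mathbb{A}\to\mathbb{A}$ be a positive twist map that preserves the Lebesgue measure. Let $U\subset\mathbb{A}$ be an $f$-periodic open set of finite Lebesgue measure. Then the following conditions are equivalent. (i) The asymptotic torsion is defined and equal to zero at every point $z\in U$. (ii) The asymptotic torsion is defined and equal to zero at $\mathrm{Leb}$-almost every point $z\in U$. (iii) No point $z\in U$ has over-conjugate points.
   Context: Notation: $\mathbb{T}=\mathbb{R}/\mathbb{Z}$, $\mathbb{A}=\mathbb{T}\times\mathbb{R}$ with the standard Riemannian metric and standard trivialization of its tangent bundle, $\mathrm{Leb}$ is Lebesgue measure on $\mathbb{A}$ (associated with $dx\wedge dy$), $\pi:\mathbb{R}^2\to\mathbb{A}$, $\pi(x,y)=(x+\mathbb{Z},y)$; a lift of $f$ is a map $F:\mathbb{R}^2\to\mathbb{R}^2$ (continuous) with $\pi\circ F=f\circ\pi$; $p_1,p_2$ are the coordinate projections. A positive (resp. negative) twist map is a $\mathcal{C}^1$ diffeomorphism $f:\mathbb{A}\to\mathbb{A}$ isotopic to the identity such that for any lift $F$ of $f$ and any $x\in\mathbb{R}$ the function $y\mapsto p_1\circ F(x,y)$ is an increasing (resp. decreasing) diffeomorphism of $\mathbb{R}$. Torsion: $T^1\mathbb{A}$ is the bundle of half-lines (non-zero tangent vectors modulo positive scaling). $v$ denotes the class of the vertical vector $(0,1)$ at any point. For $w,w'\in T^1_z\mathbb{A}$, $\prec(w,w')\in\mathbb{T}$ is the oriented (counterclockwise) angle from $w$ to $w'$ divided by $2\pi$, and $\theta(z,w)=\prec(v,w)$.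 For a continuous path $\gamma:[0,1]\to T^1\mathbb{A}$, $\int_\gamma d\theta=\Theta(1)-\Theta(0)$, where $\Theta:[0,1]\to\mathbb{R}$ is a continuous lift of $\theta\circ\gamma$. Let $(f_t)_{t\in[0,1]}$ be an isotopy in $\mathrm{Diff}^1(\mathbb{A})$ from the identity to $f$, extended to $t\ge 0$ by $f_{1+t}=f_t\circ f_1$. For $n\ge 1$, $DI^n(z,w)$ is the path $[0,1]\ni t\mapsto (f_{nt}(z),Df_{nt}(z)w)\in T^1\mathbb{A}$; the number $\int_{DI^n(z,w)}d\theta$ does not depend on the chosen isotopy. Set $\mathrm{Torsion}_n(f,z,w)=\frac1n\int_{DI^n(z,w)}d\theta$. The asymptotic torsion at $z$ is, whenever the limit exists, $\mathrm{Torsion}(f,z)=\lim_{n\to+\infty}\mathrm{Torsion}_n(f,z,w)$ (independent of $w\in T^1_z\mathbb{A}$). For a positive twist map $f$, a point $z\in\mathbb{A}$ has over-conjugate points if there exists $n\ge1$ with $\int_{DI^n(z,v)}d\theta<-\frac12$. A set $U$ is $f$-periodic if $f^M(U)=U$ for some integer $M\ge1$. *)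

(* Defs.v *)
From HB Require Import structures.
From mathcomp Require Import all_boot all_order all_algebra.
From mathcomp Require Import ring_quotient.
From mathcomp Require Import all_classical all_reals all_analysis.
Import Order.TTheory GRing.Theory Num.Theory.
Import numFieldNormedType.Exports.

Set Implicit Arguments.
Unset Strict Implicit.
Unset Printing Implicit Defensive.

Local Open Scope classical_set_scope.
Local Open Scope ring_scope.

Definition int_subgroup (R : realType) : zmodClosed R :=
  GRing.ZmodClosed.clone R Num.int_num_subdef _.

(** The circle [R / Z]: quotient group, with the quotient topology and the
    quotient sigma-algebra (which is the Borel sigma-algebra of the quotient
    topology). *)
Definition circle (R : realType) : Type :=
  quotient_topology (Quotient.quot (int_subgroup R)).

Section circle.
Context {R : realType}.

HB.instance Definition _ := PointedTopological.on (circle R).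
HB.instance Definition _ := Quotient.on (circle R).

Definition circle_pi (x : R) : circle R := \pi_(circle R)%qT x.

(** The representative is an arbitrary preimage under [circle_pi]. *)
Definition circle_repr (a : circle R) : R :=
  repr a.

Definition circle_measurable : set (set (circle R)) :=
  [set B | measurable (circle_pi @^-1` B)].

Lemma circle_measurable0 : circle_measurable set0.
Proof. by rewrite /circle_measurable /= preimage_set0. Qed.

Lemma circle_measurableC B : circle_measurable B -> circle_measurable (~` B).
Proof.
by rewrite /circle_measurable /= preimage_setC => mB; apply: measurableC.
Qed.

Lemma circle_measurable_bigcup (B : (set (circle R))^nat) :
  (forall i, circle_measurable (B i)) -> circle_measurable (\bigcup_i B i).
Proof.
move=> mB; rewrite /circle_measurable /= preimage_bigcup.
by apply: bigcup_measurable => i _; exact: mB.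
Qed.

HB.instance Definition _ := isMeasurable.Build default_measure_display
  (circle R) circle_measurable0 circle_measurableC circle_measurable_bigcup.

Lemma measurable_circle_pi : measurable_fun [set: R] circle_pi.
Proof. by move=> _ B mB; rewrite setTI. Qed.

(** Normalized Haar measure: image of the Lebesgue measure of [[0, 1[]. *)
Definition circle_lebesgue : set (circle R) -> \bar R :=
  pushforward (mrestr (@lebesgue_measure R) (measurable_itv `[0%R, 1%R[))
    circle_pi.

Lemma circle_lebesgue0 : circle_lebesgue set0 = 0%E.
Proof. by rewrite /circle_lebesgue /pushforward preimage_set0 measure0. Qed.

Lemma circle_lebesgue_ge0 B : (0 <= circle_lebesgue B)%E.
Proof. by rewrite /circle_lebesgue /pushforward; exact: measure_ge0. Qed.

Lemma circle_lebesgue_sigma_additive : semi_sigma_additive circle_lebesgue.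
Proof.
move=> F mF tF mUF; rewrite /circle_lebesgue /pushforward preimage_bigcup.
apply: measure_semi_sigma_additive.
- by move=> i; exact: mF.
- apply/trivIsetP => /= i j _ _ ij; rewrite -preimage_setI.
  by move/trivIsetP : tF => /(_ _ _ _ _ ij) ->//; rewrite preimage_set0.
- by rewrite -preimage_bigcup; exact: mUF.
Qed.

HB.instance Definition _ := isMeasure.Build _ _ _ circle_lebesgue
  circle_lebesgue0 circle_lebesgue_ge0 circle_lebesgue_sigma_additive.
End circle.

Notation plane R := (R * R)%type.
Notation annulus R := (circle R * R)%type.

Section annulus.
Context {R : realType}.
Implicit Types (f g : annulus R -> annulus R) (F : plane R -> plane R).
Implicit Types (z : annulus R) (w : plane R).
Implicit Types (I : R -> annulus R -> annulus R) (n : nat).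

Definition Leb : set (annulus R) -> \bar R :=
  (circle_lebesgue \x @lebesgue_measure R)%E.

Lemma Leb0 : Leb set0 = 0%E.
Proof. by rewrite /Leb measure0. Qed.

Lemma Leb_ge0 B : (0 <= Leb B)%E.
Proof. exact: (measure_ge0 (circle_lebesgue \x @lebesgue_measure R)%E). Qed.

Lemma Leb_sigma_additive : semi_sigma_additive Leb.
Proof.
exact: (@measure_semi_sigma_additive _ _ _
  (circle_lebesgue \x @lebesgue_measure R)%E).
Qed.

HB.instance Definition _ := isMeasure.Build _ (annulus R) R Leb
  Leb0 Leb_ge0 Leb_sigma_additive.

Definition annulus_pi (p : plane R) : annulus R := (circle_pi p.1, p.2).

Definition annulus_repr z : plane R := (circle_repr z.1, z.2).

Definition is_lift f F : Prop :=
  continuous F /\ forall p, annulus_pi (F p) = f (annulus_pi p).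

Definition C1 (V W : normedModType R) (G : V -> W) : Prop :=
  (forall p, differentiable G p) /\ (forall v, continuous (fun p => 'd G p v)).

(** [annulus_pi] is a local diffeomorphism and a universal covering, so [f] is
    of class C^1 iff it has a lift of class C^1. *)
Definition annulus_C1 f : Prop := exists2 F, is_lift f F & C1 F.

Definition annulus_diffeo1 f : Prop :=
  exists g, [/\ cancel f g, cancel g f, annulus_C1 f & annulus_C1 g].

(** The differential in the standard trivialization of the tangent bundle.
    Neither the choice of the lift [F] nor that of the point above [z] matters:
    two lifts differ by a constant (k, 0) with k an integer, and so do
    [F (x + 1, y)] and [F (x, y)]. *)
Definition annulus_d f z w : plane R := 'd (get (is_lift f)) (annulus_repr z) w.

(** [I], restricted to [[0, 1]], is a continuous path in Diff^1 of the annulus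
    from the identity to [f]. As the annulus is locally compact, continuity for
    the C^1 compact-open topology amounts to joint continuity of the values and
    of the differentials. *)
Definition isotopy I f : Prop :=
  [/\ forall t, t \in `[0, 1] -> annulus_diffeo1 (I t),
      {within `[0, 1] `*` [set: annulus R],
         continuous (fun p : R * annulus R => I p.1 p.2)},
      forall w, {within `[0, 1] `*` [set: annulus R],
         continuous (fun p : R * annulus R => annulus_d (I p.1) p.2 w)},
      I 0 = id & I 1 = f].

Definition isotopic_to_id f : Prop := exists I, isotopy I f.

Definition increasing_diffeo (h : R -> R) : Prop :=
  {homo h : x y / x < y} /\
  exists k, [/\ cancel h k, cancel k h, C1 h & C1 k].

Definition positive_twist f : Prop :=
  [/\ annulus_diffeo1 f, isotopic_to_id f &
      forall F, is_lift f F -> forall x, increasing_diffeo (fun y => (F (x, y)).1)].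

Definition preserves_Leb f : Prop :=
  forall B, measurable B -> Leb (f @^-1` B) = Leb B.

(** [f_(k + s) = f_s \o f ^ k] for [k] a natural number and [0 <= s < 1]. *)
Definition extend_isotopy I (t : R) : annulus R -> annulus R :=
  I (t - (Num.truncn t)%:R) \o iter (Num.truncn t) (I 1).

(** Half-lines of the tangent plane at [z] are represented by nonzero vectors
    of [plane R]; everything below depends on [w] only up to positive scaling. *)
Definition vertical : plane R := (0, 1).

Definition rotate (a : R) w : plane R :=
  (cos a * w.1 - sin a * w.2, sin a * w.1 + cos a * w.2).

(** Oriented angle divided by [2 * pi]; unique for nonzero [w] and [w']. *)
Definition oriented_angle w w' : circle R :=
  get [set a | exists s r : R,
         [/\ a = circle_pi s, 0 < r & w' = r *: rotate (2 * pi * s) w]].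

Definition theta (zw : annulus R * plane R) : circle R :=
  oriented_angle vertical zw.2.

(** The integral of [d theta] along [gamma]; it does not depend on the lift
    [Theta], which exists as soon as [theta \o gamma] is continuous. *)
Definition int_dtheta (gamma : R -> annulus R * plane R) : R :=
  get [set r | exists Theta : R -> R,
         [/\ {within `[0, 1], continuous Theta},
             forall t, t \in `[0, 1] -> circle_pi (Theta t) = theta (gamma t) &
             r = Theta 1 - Theta 0]].

Definition DI I n z w : R -> annulus R * plane R := fun t =>
  (extend_isotopy I (n%:R * t) z, annulus_d (extend_isotopy I (n%:R * t)) z w).

Definition Torsion_n I n z w : R := n%:R^-1 * int_dtheta (DI I n z w).

Definition asymptotic_torsion I z (tau : R) : Prop :=
  forall w, w != 0 -> Torsion_n I n z w @[n --> \oo] --> tau.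

Definition over_conjugate I z : Prop :=
  exists2 n, (1 <= n)%N & int_dtheta (DI I n z vertical) < - 2^-1.

Definition periodic_set f (U : set (annulus R)) : Prop :=
  exists2 M, (1 <= M)%N & iter M f @` U = U.

End annulus.

(* Main.v *)
Require Import Defs.
From HB Require Import structures.
From mathcomp Require Import all_boot all_order all_algebra.
From mathcomp Require Import ring_quotient.
From mathcomp Require Import all_classical all_reals all_analysis.
From mathcomp Require Import measurable_realfun.
From mathcomp Require Import ring lra zify.
Import Order.TTheory GRing.Theory Num.Theory.
Import numFieldNormedType.Exports.

(** Angles are counted in turns. The differential of the isotopy at [z] moves
    a half-line of angle [a] along a path whose angle, followed continuously,
    ends at [turn z a]. As the differential is linear and never singular,
    [turn z] is an increasing map of the line that commutes with the translation
    by [1/2]. If [w] has the angle [a], the number [int_dtheta (DI I n z w)] is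
    the displacement of [a] under the [n]-fold composition [turns n z] of these
    maps along the orbit of [z] ([int_dtheta_DI]).

    The twist condition says that the differential of [f] tilts the vertical to
    the right, so [turn z 0] lies strictly between [k - 1/2] and [k] for some
    integer [k], the same for all [z] on a circle where [y] is constant. The
    heart of the topological part is that [k = 0] ([turn_range]). A path of
    invertible matrices from the identity to the differential could produce any
    [k]; what excludes the others is that the path comes from an isotopy of the
    annulus: for a lift [F_t] of the isotopy, the vector
    [F_t (x + s, y) - F_t (x, y)] never vanishes for [0 < s <= 1], is constant
    in [t] when [s = 1], and after division by [s] tends to the image of the
    horizontal vector when [s] tends to [0]. The total rotation of this vector
    between the times [0] and [1] is thus continuous in [s] and vanishes at
    [s = 1]. If [x] is chosen so that the height of [F_1] on the circle is
    maximal at [(x, y)], then the vector never points strictly upwards at time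
    [1], which bounds the rotation of the horizontal vector on one side; a
    minimum of the height bounds it on the other side.

    Consequently [turns n z 0 <= 0] for all [n], and once it is below [-1/2] it
    remains so. If [z] has no over-conjugate points, then [turns n z 0] stays in
    [[-1/2, 0]], every [turns n z a - a] is bounded, and the torsion vanishes:
    (iii) implies (i). That (i) implies (ii) is clear.

    For (ii) implies (iii), suppose that [z0] in [U] has over-conjugate points,
    and let [L] be a large multiple of the period of [U]. The set [V] of the
    points [z] of [U] with [turns L z 0 < -1/2] is open and nonempty. Each
    visit of the orbit of [z] under the [L]-th iterate of [f] to [V] costs
    another half turn, so [turns (k * L) z 0] is at most minus half the number
    of visits before time [k] ([turns_visits]). If the torsion is zero almost
    everywhere, the frequency of visits tends to zero almost everywhere on
    [U]; but its integral over [U] is the measure of [V] at all times, because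
    [f] preserves the measure. By dominated convergence [V] has measure zero
    ([visits_density0]), which is absurd for a nonempty open set. *)

Set Implicit Arguments.
Unset Strict Implicit.
Unset Printing Implicit Defensive.

Local Open Scope classical_set_scope.
Local Open Scope ring_scope.

(** * Angles of plane vectors, counted in turns *)

Section angles.
Context {R : realType}.
Implicit Types (a b : R) (u w : plane R).

(** The origin of angles is the vertical direction, as in the definition of [theta]. *)
Definition dir a : plane R := (- sin (2 * pi * a), cos (2 * pi * a)).
Definition has_angle a w := exists2 r, 0 < r & w = r *: dir a.
Definition cross u w := u.1 * w.2 - u.2 * w.1.
Definition dot u w := u.1 * w.1 + u.2 * w.2.

Lemma fstZ (r : R) w : (r *: w).1 = r * w.1. Proof. by []. Qed.
Lemma sndZ (r : R) w : (r *: w).2 = r * w.2. Proof. by []. Qed.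

Lemma plane_eq u w : u.1 = w.1 -> u.2 = w.2 -> u = w.
Proof. by case: u w => ? ? [? ?] /= -> ->. Qed.

Lemma cross_dir a b : cross (dir a) (dir b) = sin (2 * pi * (b - a)).
Proof. by rewrite /cross /dir /= mulrBr sinB; ring. Qed.

Lemma dot_dir a b : dot (dir a) (dir b) = cos (2 * pi * (b - a)).
Proof. by rewrite /dot /dir /= mulrBr cosB; ring. Qed.

Lemma crossZ (r s : R) u w : cross (r *: u) (s *: w) = r * s * cross u w.
Proof. by rewrite /cross !fstZ !sndZ; ring. Qed.

Lemma dotZ (r s : R) u w : dot (r *: u) (s *: w) = r * s * dot u w.
Proof. by rewrite /dot !fstZ !sndZ; ring. Qed.

Lemma pi2_gt0 : 0 < 2 * pi :> R.
Proof. by rewrite mulr_gt0 // pi_gt0. Qed.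

Lemma sin2pi_gt0 a : 0 < a < 2^-1 -> 0 < sin (2 * pi * a).
Proof.
move=> /andP[a0 a1]; apply: sin_gt0_pi; rewrite mulr_gt0 ?pi2_gt0 //=.
have := @pi_gt0 R; nra.
Qed.

Lemma sin_half : sin (2 * pi * 2^-1) = 0 :> R.
Proof. by rewrite (_ : 2 * pi * 2^-1 = pi :> R) ?sinpi //; field. Qed.

Lemma dirD1 a : dir (a + 1) = dir a.
Proof.
rewrite /dir (_ : 2 * pi * (a + 1) = 2 * pi * a + pi *+ 2); last by rewrite mulr2n; ring.
by rewrite sinD2pi cosD2pi.
Qed.

Lemma dirD_half a : dir (a + 2^-1) = - dir a.
Proof.
rewrite /dir (_ : 2 * pi * (a + 2^-1) = 2 * pi * a + pi); last by field.
by rewrite sinDpi cosDpi.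
Qed.

Lemma dirDn a n : dir (a + n%:R) = dir a.
Proof.
by elim: n => [|n IH]; rewrite ?addr0 // -natr1 addrA dirD1.
Qed.

Lemma dirDz a (m : int) : dir (a + m%:~R) = dir a.
Proof.
case: m => n; first exact: dirDn.
by rewrite NegzE mulrNz -(dirDn _ n.+1) subrK.
Qed.

Lemma has_angle_dir a : has_angle a (dir a).
Proof. by exists 1; rewrite ?scale1r. Qed.

Lemma has_angle_neq0 a w : has_angle a w -> w != 0.
Proof.
case=> r r0 ->; apply/eqP => -[/eqP + /eqP].
rewrite mulf_eq0 (gt_eqF r0) /= mulf_eq0 (gt_eqF r0) /= oppr_eq0 => /eqP s0 /eqP c0.
have := cos2Dsin2 (2 * pi * a); rewrite s0 c0 expr0n /= addr0 => /eqP.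
by rewrite eq_sym oner_eq0.
Qed.

Lemma dir_neq0 a : dir a != 0.
Proof. exact: has_angle_neq0 (has_angle_dir a). Qed.

(** After reduction of [a] modulo [1], injectivity of the cosine on [[0, pi]] applies
    either to [2 pi a] or, by symmetry, to [2 pi (1 - a)]. *)
Lemma cos2pi_eq1 a : cos (2 * pi * a) = 1 -> a \is a Num.int.
Proof.
move=> ca.
pose b := a - (Num.floor a)%:~R.
have cb : cos (2 * pi * b) = 1.
  have := dirDz a (- Num.floor a); rewrite /dir mulrNz => -[_].
  by rewrite ca.
have /andP[b0 b1] : 0 <= b < 1.
  by have := floor_itv a; rewrite intrD => /andP[? ?]; apply/andP; split; rewrite /b; lra.
suff b_eq0 : b = 0.
  by move/eqP: b_eq0; rewrite subr_eq0 => /eqP ->; exact: intr_int.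
have p0 := @pi_gt0 R.
have [bh|bh] := leP b 2^-1.
  have : 2 * pi * b = 0.
    apply: cos_inj; rewrite ?in_itv /= ?lexx ?(ltW p0) ?cb ?cos0 //.
    by apply/andP; split; nra.
  by move/eqP; rewrite mulf_eq0 (gt_eqF pi2_gt0) => /eqP.
have cb' : cos (2 * pi * (1 - b)) = 1.
  have := dirD1 (- b); rewrite /dir addrC => -[_].
  by rewrite mulrN cosN cb.
have : 2 * pi * (1 - b) = 0.
  apply: cos_inj; rewrite ?in_itv /= ?lexx ?(ltW p0) ?cb' ?cos0 //.
  by apply/andP; split; nra.
by move/eqP; rewrite mulf_eq0 (gt_eqF pi2_gt0) /= subr_eq0 => /eqP b1'; rewrite -b1' ltxx in b1.
Qed.

Lemma has_angle_int a b w : has_angle a w -> has_angle b w -> b - a \is a Num.int.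
Proof.
move=> [r r0 wr] [s s0 ws]; apply: cos2pi_eq1.
have c0 : sin (2 * pi * (b - a)) = 0.
  have : cross w w = 0 by rewrite /cross; ring.
  rewrite {1}wr ws crossZ cross_dir => /eqP.
  by rewrite mulf_eq0 (gt_eqF (mulr_gt0 r0 s0)) => /eqP.
have d0 : 0 < cos (2 * pi * (b - a)).
  have : 0 <= dot w w by rewrite /dot; nra.
  rewrite {1}wr ws dotZ dot_dir le_eqVlt pmulr_rgt0 ?mulr_gt0 // => /orP[|//].
  rewrite eq_sym mulf_eq0 (gt_eqF (mulr_gt0 r0 s0)) /= => /eqP k0.
  by have := cos2Dsin2 (2 * pi * (b - a)); rewrite c0 k0 expr0n /= addr0 => /eqP;
    rewrite eq_sym oner_eq0.
by have := sin0cos1 c0; rewrite gtr0_norm.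
Qed.

Lemma dot_gt0 (w : plane R) : w != 0 -> 0 < dot w w.
Proof.
move=> w0; rewrite lt_neqAle eq_sym /dot; apply/andP; split; last by nra.
apply: contra w0; rewrite -!expr2 paddr_eq0 ?sqr_ge0 // !sqrf_eq0 => /andP[/eqP w1 /eqP w2].
exact/eqP/plane_eq.
Qed.

Lemma has_angle_exists w : w != 0 -> exists2 a, 0 <= a < 1 & has_angle a w.
Proof.
move=> w0; pose n := Num.sqrt (dot w w).
have d0 := dot_gt0 w0.
have n0 : 0 < n by rewrite sqrtr_gt0.
have nn : n ^+ 2 = dot w w by rewrite sqr_sqrtr // ltW.
pose u := w.1 / n; pose v := w.2 / n.
have uv : u ^+ 2 + v ^+ 2 = 1.
  rewrite /u /v !expr_div_n -mulrDl !expr2 -/(dot w w) -nn expr2 divff //.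
  by rewrite mulf_neq0 // gt_eqF.
have wuv : w = n *: (u, v) :> plane R.
  rewrite /u /v; apply: plane_eq; rewrite ?fstZ ?sndZ /=.
    by rewrite -[LHS](divfK (lt0r_neq0 n0)) mulrC.
  by rewrite -[LHS](divfK (lt0r_neq0 n0)) mulrC.
have v1 : -1 <= v <= 1 by apply/andP; split; nra.
have p0 := @pi_gt0 R.
have sv : Num.sqrt (1 - v ^+ 2) = `|u|.
  by rewrite -uv [u ^+ 2 + _]addrC [v ^+ 2 + _]addrC addrK sqrtr_sqr.
have Kv (b := acos v / (2 * pi)) : 2 * pi * b = acos v.
  by rewrite mulrC mulfVK // gt_eqF // pi2_gt0.
have [u0|u0] := leP u 0.
  exists (acos v / (2 * pi)).
    rewrite divr_ge0 ?acos_ge0 ?(ltW pi2_gt0) //= ltr_pdivrMr ?pi2_gt0 // mul1r.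
    by have := acos_lepi v1; lra.
  exists n => //; rewrite wuv; congr (_ *: _); rewrite /dir Kv.
  by rewrite sin_acos // sv ler0_norm // opprK acosK.
(* On the other half circle, [2 pi - acos v] is the angle. *)
have v1' : v < 1 by nra.
have av0 : 0 < acos v by apply: acos_gt0; rewrite v1'; case/andP: v1 => ->.
exists (- (acos v / (2 * pi)) + 1).
  apply/andP; split; last first.
    by rewrite gtrDr oppr_lt0 divr_gt0 ?pi2_gt0.
  rewrite addrC subr_ge0 ler_pdivrMr ?pi2_gt0 // mul1r.
  by have := acos_lepi v1; lra.
exists n => //; rewrite wuv; congr (_ *: _); rewrite dirD1 /dir mulrN Kv.
by rewrite sinN cosN sin_acos // sv gtr0_norm // opprK acosK.
Qed.

(** The angle from [u] to [w] is less than a quarter turn since the scalar product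
    is positive, so the arctangent determines it, continuously in [w]. *)
Lemma has_angle_atan a u w : has_angle a u -> 0 < dot u w ->
  has_angle (a + atan (cross u w / dot u w) / (2 * pi)) w.
Proof.
move=> [r r0 ->] d0.
set d := dot _ _ in d0 *; set c := cross _ _.
set f := atan (c / d).
have cf0 : 0 < cos f.
  by apply: cos_gt0_pihalf; rewrite atan_gtNpi2 atan_ltpi2.
have sf : sin f = c / d * cos f.
  by rewrite -[c / d]atanK -/f /tan mulfVK // gt_eqF.
exists (d / (r * cos f)); first by rewrite divr_gt0 // mulr_gt0.
have E : 2 * pi * (a + f / (2 * pi)) = 2 * pi * a + f.
  by rewrite mulrDr [_ * (f / _)]mulrC mulfVK // gt_eqF // pi2_gt0.
have E2 : cos (2 * pi * a) ^+ 2 + sin (2 * pi * a) ^+ 2 = 1 := cos2Dsin2 _.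
rewrite /dir E sinD cosD sf.
apply: plane_eq.
  rewrite fstZ /=.
  have -> : d / (r * cos f) * - (sin (2 * pi * a) * cos f + cos (2 * pi * a) * (c / d * cos f))
     = - (d * sin (2 * pi * a) + c * cos (2 * pi * a)) / r.
    by field; rewrite !gt_eqF.
  rewrite /d /c /dot /cross !fstZ !sndZ /=.
  move: (sin _) (cos _) E2 => s k E2; rewrite -[LHS]mulr1 -E2; field.
  by rewrite gt_eqF.
rewrite sndZ /=.
have -> : d / (r * cos f) * (cos (2 * pi * a) * cos f - sin (2 * pi * a) * (c / d * cos f))
     = (d * cos (2 * pi * a) - c * sin (2 * pi * a)) / r.
  by field; rewrite !gt_eqF.
rewrite /d /c /dot /cross !fstZ !sndZ /=.
move: (sin _) (cos _) E2 => s k E2; rewrite -[LHS]mulr1 -E2; field.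
by rewrite gt_eqF.
Qed.

End angles.

(** * Continuous determination of the angle along a path *)

Section lifts.
Context {R : realType}.
Implicit Types (a b c : R) (W : R -> plane R) (T : R -> R).

(** The intermediate value theorem in the form used below: a continuous function
    that never takes the value [c] stays on its side of [c]. *)
Lemma avoid_lt (f : R -> R) a b c : a <= b -> continuous f -> f a < c ->
  (forall t, t \in `[a, b] -> f t != c) -> f b < c.
Proof.
move=> ab cf fa fc; rewrite ltNge; apply/negP => cb.
have [] := @IVT R f a b c ab.
- exact: continuous_subspaceT.
- by rewrite ge_min le_max (ltW fa) cb orbT.
- by move=> t tab ft; have := fc t tab; rewrite ft eqxx.
Qed.

Lemma avoid_gt (f : R -> R) a b c : a <= b -> continuous f -> c < f a ->
  (forall t, t \in `[a, b] -> f t != c) -> c < f b.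
Proof.
move=> ab cf fa fc; rewrite -ltrN2; apply: (@avoid_lt (fun t => - f t) a b) => //.
- by move=> t; apply: cvgN; exact: cf.
- by rewrite ltrN2.
- by move=> t tab; rewrite eqr_opp; exact: fc.
Qed.

(** Otherwise the function would cross a half-integer. *)
Lemma int_valued_const (f : R -> R) a b : a <= b -> continuous f ->
  (forall t, t \in `[a, b] -> f t \is a Num.int) -> f a = f b.
Proof.
move=> ab cf fi.
have nh (m : R) : m \is a Num.int -> forall t, t \in `[a, b] -> f t != m + 2^-1.
  move=> /intrP[k ->] t /fi /intrP[l ->]; apply/eqP => lk.
  suff : (2 * l)%:~R = (2 * k + 1)%:~R :> R by move/intr_inj; lia.
  by rewrite intrM (intrD _ (2 * k) 1) intrM lk mulrDr [_ * 2^-1]mulfV ?pnatr_eq0.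
have ia : a \in `[a, b] by rewrite in_itv /= lexx.
have ib : b \in `[a, b] by rewrite in_itv /= lexx andbT.
have h1 : f b < f a + 2^-1.
  by apply: (avoid_lt ab cf); [rewrite ltrDl|exact/nh/fi].
have h2 : f a - 1 + 2^-1 < f b.
  apply: (avoid_gt ab cf); first by rewrite -addrA gtrDl; lra.
  by apply: nh; rewrite rpredB ?rpred1 ?fi.
have := rpredB (fi _ ib) (fi _ ia) => /intrP[k kE].
have k1 : (-1)%:~R < k%:~R :> R by rewrite -kE; lra.
have k2 : k%:~R < 1%:~R :> R by rewrite -kE; lra.
rewrite !ltr_int in k1 k2.
have k0 : k = 0 by lia.
by apply/eqP; rewrite eq_sym -subr_eq0 kE k0.
Qed.

Lemma continuous_fst (X Y Z : topologicalType) (h : X -> Y * Z) :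
  continuous h -> continuous (fun x => (h x).1).
Proof. by move=> ch x; exact: (cvg_comp _ _ (ch x) (@cvg_fst _ _ _ _ _)). Qed.

Lemma continuous_snd (X Y Z : topologicalType) (h : X -> Y * Z) :
  continuous h -> continuous (fun x => (h x).2).
Proof. by move=> ch x; exact: (cvg_comp _ _ (ch x) (@cvg_snd _ _ _ _ _)). Qed.

Lemma continuousT_comp (X Y Z : topologicalType) (h : X -> Y) (k : Y -> Z) :
  continuous h -> continuous k -> continuous (fun x => k (h x)).
Proof. by move=> ch ck x; apply: continuous_comp; [exact: ch|exact: ck]. Qed.

Lemma continuous_idT (X : topologicalType) : continuous (fun x : X => x).
Proof. by move=> x; exact: cvg_id. Qed.

Lemma continuous_cstT (X Y : topologicalType) (y : Y) : continuous (fun x : X => y).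
Proof. by move=> x; exact: cvg_cst. Qed.

Lemma continuous_within_comp (X Y Z : topologicalType) (A : set Y) (k : Y -> Z) (h : X -> Y) :
  {within A, continuous k} -> continuous h -> (forall x, A (h x)) ->
  continuous (fun x => k (h x)).
Proof.
move=> /subspace_continuousP ck ch Ah x.
apply: cvg_comp (ck (h x) (Ah x)) => B /=; rewrite /within /= => /ch.
by rewrite /nbhs /=; apply: filterS => y; apply; exact: Ah.
Qed.

Lemma continuous_pair (X Y Z : topologicalType) (f : X -> Y) (g : X -> Z) :
  continuous f -> continuous g -> continuous (fun x => (f x, g x)).
Proof. by move=> cf cg x; exact: (cvg_pair (cf x) (cg x)). Qed.

Lemma continuousZ (X : topologicalType) (k : X -> R) (w : X -> plane R) :
  continuous k -> continuous w -> continuous (fun x => k x *: w x).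
Proof. by move=> ck cw x; apply: cvgZ; [exact: ck|exact: cw]. Qed.

Lemma continuous_cross (X : topologicalType) (u w : X -> plane R) :
  continuous u -> continuous w -> continuous (fun x => cross (u x) (w x)).
Proof.
move=> cu cw x; apply: cvgB; apply: cvgM.
- exact: (cvg_comp _ _ (cu x) (@cvg_fst _ _ _ _ _)).
- exact: (cvg_comp _ _ (cw x) (@cvg_snd _ _ _ _ _)).
- exact: (cvg_comp _ _ (cu x) (@cvg_snd _ _ _ _ _)).
- exact: (cvg_comp _ _ (cw x) (@cvg_fst _ _ _ _ _)).
Qed.

Lemma continuous_dot (X : topologicalType) (u w : X -> plane R) :
  continuous u -> continuous w -> continuous (fun x => dot (u x) (w x)).
Proof.
move=> cu cw x; apply: cvgD; apply: cvgM.
- exact: (cvg_comp _ _ (cu x) (@cvg_fst _ _ _ _ _)).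
- exact: (cvg_comp _ _ (cw x) (@cvg_fst _ _ _ _ _)).
- exact: (cvg_comp _ _ (cu x) (@cvg_snd _ _ _ _ _)).
- exact: (cvg_comp _ _ (cw x) (@cvg_snd _ _ _ _ _)).
Qed.

Lemma continuous_dir : continuous (@dir R).
Proof.
have c1 : continuous (fun a : R => 2 * pi * a).
  by move=> a; apply: cvgM; [exact: cvg_cst|exact: cvg_id].
apply: continuous_pair => a.
  by apply: cvgN; apply: (continuousT_comp c1); exact: continuous_sin.
by apply: (continuousT_comp c1); exact: continuous_cos.
Qed.

Definition angle_lift W a T :=
  [/\ continuous T, T 0 = a & forall t, t \in `[0, 1] -> has_angle (T t) (W t)].

(** Replacing a time [t] by [clamp 0 1 t] turns a path on [[0, 1]] into a path
    defined and continuous on the whole line. *)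
Definition clamp (x y t : R) := Num.max x (Num.min t y).

Lemma clamp_id x y t : t \in `[x, y] -> clamp x y t = t.
Proof. by rewrite in_itv /= => /andP[? ?]; rewrite /clamp min_l // max_r. Qed.

Lemma clamp_in x y t : x <= y -> clamp x y t \in `[x, y].
Proof. by move=> xy; rewrite in_itv /= /clamp le_max lexx /= ge_max xy ge_min lexx orbT. Qed.

Lemma clamp011 : clamp 0 1 1 = 1 :> R.
Proof. by rewrite clamp_id // in_itv /= ler01 lexx. Qed.

Lemma continuous_clamp x y : continuous (clamp x y).
Proof.
move=> t; apply: (@continuous_max R R (fun=> x) (fun t => Num.min t y)).
  exact: cvg_cst.
by apply: (@continuous_min R R id (fun=> y)); [exact: cvg_id|exact: cvg_cst].
Qed.

(** By compactness of [[0, 1]] there is a step [d] such that [W t] and [W (t + s)]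
    have a positive scalar product for [s <= d]; the lift is then prolonged by
    [d] at a time with [has_angle_atan]. *)
Lemma angle_lift_exists W a : continuous W ->
  (forall t, t \in `[0, 1] -> W t != 0) -> has_angle a (W 0) ->
  exists T, angle_lift W a T.
Proof.
move=> cW W0 aW.
have [d d0 dP] : exists2 d : R, 0 < d & forall t s, t \in `[0, 1] -> s \in `[0, d] ->
    0 < dot (W t) (W (t + s)).
  have /compact_near_coveringP/(_ R (nbhs 0) (fun s t => 0 < dot (W t) (W (t + s)))) :=
    @segment_compact R 0 1.
  move=> /(_ _ _)[].
    move=> t tI /=.
    pose F (ts : R * R) := dot (W ts.1) (W (ts.1 + ts.2)).
    have cF : continuous F.
      apply: continuous_dot => ts.
        by apply: continuous_comp; [exact: cvg_fst|exact: cW].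
      apply: continuous_comp; last exact: cW.
      by apply: cvgD; [exact: cvg_fst|exact: cvg_snd].
    have F0 : 0 < F (t, 0) by rewrite /F /= addr0; exact/dot_gt0/W0.
    exact: (cvgr_gt (F (t, 0)) (cF (t, 0)) 0 F0).
  move=> e /= e0 eP; exists (e / 2); first by rewrite divr_gt0.
  move=> t s tI; rewrite in_itv /= => /andP[s0 se].
  apply: (eP s) => //=; rewrite sub0r normrN ger0_norm //.
  by apply: (le_lt_trans se); rewrite ltr_pdivrMr // ltr_pMr // ltr1n.
have step n : exists T, [/\ continuous T, T 0 = a &
    forall t, t \in `[0, 1] -> t <= n%:R * d -> has_angle (T t) (W t)].
  elim: n => [|n [T [cT T0 TP]]].
    exists (fun=> a); split => // [t|t]; first exact: cvg_cst.
    rewrite in_itv /= mul0r => /andP[t0 _] t0'.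
    by have -> : t = 0 by apply/eqP; rewrite eq_le t0 t0'.
  pose x := n%:R * d.
  have x0 : 0 <= x by rewrite mulr_ge0 // ltW.
  have [x1|x1] := leP 1 x.
    exists T; split => // t tI _; apply: TP => //.
    by move: tI; rewrite in_itv /= => /andP[_ /le_trans]; apply.
  have xI : x \in `[0, 1] by rewrite in_itv /= x0 ltW.
  pose s t := clamp 0 d (t - x).
  have sI t : s t \in `[0, d] by apply/clamp_in/ltW.
  have cs : continuous s.
    move=> t; apply: (@continuous_comp _ _ _ (fun t => t - x) (clamp 0 d)).
      by apply: cvgB; [exact: cvg_id|exact: cvg_cst].
    exact: continuous_clamp.
  have cWs : continuous (fun t => W (x + s t)).
    move=> t; apply: (@continuous_comp _ _ _ (fun t => x + s t) W); last exact: cW.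
    by apply: cvgD; [exact: cvg_cst|exact: cs].
  pose q t := cross (W x) (W (x + s t)) / dot (W x) (W (x + s t)).
  have cq : continuous q.
    move=> t; apply: cvgM.
      by apply: continuous_cross => // ?; exact: cvg_cst.
    apply: cvgV; first by rewrite gt_eqF ?dP.
    by apply: continuous_dot => // ?; exact: cvg_cst.
  pose g t := atan (q t) / (2 * pi).
  have cg : continuous g.
    move=> t; apply: cvgM; last exact: cvg_cst.
    by apply: (@continuous_comp _ _ _ q (@atan R)); [exact: cq|exact: continuous_atan].
  exists (fun t => T (Num.min t x) + g t); split.
  - move=> t; apply: cvgD; last exact: cg.
    apply: (@continuous_comp _ _ _ (fun t => Num.min t x) T); last exact: cT.
    by apply: (@continuous_min R R id (fun=> x)); [exact: cvg_id|exact: cvg_cst].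
  - rewrite min_l // T0 /g /q /s /clamp sub0r min_l ?(le_trans (lerN10 _)) //; last first.
      by rewrite (le_trans _ (ltW d0)) // oppr_le0.
    rewrite max_l ?oppr_le0 // addr0.
    by rewrite (_ : cross _ _ = 0) ?mul0r ?atan0 ?mul0r ?addr0 // /cross; ring.
  - move=> t tI tn; have [tx|xt] := leP t x.
      have s0 : s t = 0 by rewrite /s /clamp min_l ?max_l ?subr_le0 // (le_trans _ (ltW d0)) // subr_le0.
      rewrite /g /q s0 addr0 (_ : cross _ _ = 0) ?mul0r ?atan0 ?mul0r ?addr0; first exact: TP.
      by rewrite /cross; ring.
    have st : s t = t - x.
      rewrite /s clamp_id // in_itv /= subr_ge0 (ltW xt) /= lerBlDl.
      by move: tn; rewrite -natr1 mulrDl mul1r.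
    have := @has_angle_atan R (T x) (W x) (W (x + s t)) (TP x xI (lexx _)) (dP _ _ xI (sI t)).
    by rewrite {3}st addrCA subrr addr0.
pose n := (Num.truncn (d^-1)).+1.
have [T [cT T0 TP]] := step n; exists T; split => // t tI; apply: TP => //.
move: tI; rewrite in_itv /= => /andP[_ t1]; apply: (le_trans t1).
rewrite -ler_pdivrMr // mul1r; exact/ltW/truncnS_gt.
Qed.

Lemma angle_lift_sub W a b T S : angle_lift W a T -> angle_lift W b S ->
  forall t, t \in `[0, 1] -> T t - S t = a - b.
Proof.
move=> [cT T0 TP] [cS S0 SP] t; rewrite in_itv /= => /andP[t0 t1].
rewrite -T0 -S0; symmetry; apply: (@int_valued_const (fun t => T t - S t) 0 t t0).
  by move=> x; apply: cvgB; [exact: cT|exact: cS].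
move=> x; rewrite in_itv /= => /andP[x0 xt].
have xI : x \in `[0, 1] by rewrite in_itv /= x0 (le_trans xt).
exact: has_angle_int (SP _ xI) (TP _ xI).
Qed.

Lemma sin_has_angle a b (u w : plane R) : has_angle a u -> has_angle b w ->
  cross u w != 0 -> sin (2 * pi * (b - a)) != 0.
Proof.
move=> [r r0 ->] [s s0 ->]; rewrite crossZ cross_dir.
by rewrite !mulf_eq0 => /norP[].
Qed.

(** Two paths of vectors that are never parallel cannot change their order: the
    difference of their angles avoids [0] and [1/2]. *)
Lemma angle_lift_sep W W' a b T S : angle_lift W a T -> angle_lift W' b S ->
  (forall t, t \in `[0, 1] -> cross (W t) (W' t) != 0) ->
  0 < b - a < 2^-1 -> 0 < S 1 - T 1 < 2^-1.
Proof.
move=> [cT T0 TP] [cS S0 SP] cr; rewrite -T0 -S0 => /andP[h0 h1].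
have cf : continuous (fun t => S t - T t).
  by move=> x; apply: cvgB; [exact: cS|exact: cT].
have sn t (tI : t \in `[0, 1]) := sin_has_angle (TP t tI) (SP t tI) (cr t tI).
apply/andP; split.
  apply: (@avoid_gt _ 0 1 _ _ cf) => // t /sn; apply: contra => /eqP ->.
  by rewrite mulr0 sin0.
apply: (@avoid_lt _ 0 1 _ _ cf) => // t /sn; apply: contra => /eqP ->.
by rewrite sin_half.
Qed.

Definition lift_of W a : R -> R := get [set T | angle_lift W a T].

Lemma lift_ofP W a : continuous W -> (forall t, t \in `[0, 1] -> W t != 0) ->
  has_angle a (W 0) -> angle_lift W a (lift_of W a).
Proof.
move=> cW W0 aW; have [T TP] := angle_lift_exists cW W0 aW.
exact: (@getI _ [set T | angle_lift W a T] T).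
Qed.

Definition rot (a : R) (w : plane R) : plane R := rotate (2 * pi * a) w.

Lemma rot_dir a b : rot a (dir b) = dir (b + a).
Proof. by rewrite /rot /rotate /dir (mulrDr _ b a) sinD cosD; apply: plane_eq => /=; ring. Qed.

Lemma rotZ a r w : rot a (r *: w) = r *: rot a w.
Proof. by apply: plane_eq; rewrite /rot /rotate /= ?fstZ ?sndZ; rewrite -?[_ *: _]/(_ * _); ring. Qed.

Lemma has_angle_rot a b w : has_angle b w -> has_angle (b + a) (rot a w).
Proof. by move=> [r r0 ->]; exists r => //; rewrite rotZ rot_dir. Qed.

Lemma cross_rot a w : cross w (rot a w) = sin (2 * pi * a) * dot w w.
Proof. by rewrite /cross /rot /rotate /dot /=; ring. Qed.

Lemma continuous_rot (X : topologicalType) a (w : X -> plane R) :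
  continuous w -> continuous (fun x => rot a (w x)).
Proof.
move=> cw; apply: continuous_pair => x; [apply: cvgB|apply: cvgD]; (apply: cvgM; first exact: cvg_cst).
- exact: (cvg_comp _ _ (cw x) (@cvg_fst _ _ _ _ _)).
- exact: (cvg_comp _ _ (cw x) (@cvg_snd _ _ _ _ _)).
- exact: (cvg_comp _ _ (cw x) (@cvg_fst _ _ _ _ _)).
- exact: (cvg_comp _ _ (cw x) (@cvg_snd _ _ _ _ _)).
Qed.

(** Near [x0], the path [W (t, x)] stays for all [t] strictly between the
    rotations of [W (t, x0)] by the angles [-e] and [e], by compactness of
    [[0, 1]]. Then [angle_lift_sep] keeps its final angle between those of the
    rotated paths. *)
Lemma continuous_lift_end (X : topologicalType) (W : R * X -> plane R) (a : X -> R) :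
  continuous W -> continuous a -> (forall x t, t \in `[0, 1] -> W (t, x) != 0) ->
  (forall x, has_angle (a x) (W (0, x))) ->
  continuous (fun x => lift_of (fun t => W (t, x)) (a x) 1).
Proof.
move=> cW ca W0 aW x0.
have cWx x : continuous (fun t => W (t, x)).
  move=> t; apply: (@continuous_comp _ _ _ (fun t => (t, x)) W); last exact: cW.
  by apply: continuous_pair => ?; [exact: cvg_id|exact: cvg_cst].
have LP x := @lift_ofP (fun t => W (t, x)) (a x) (cWx x) (W0 x) (aW x).
apply/cvgrPdist_lt => e0 e0_gt0.
(* The initial angles may differ by [e] as well, so that [e + e] must be less than [1/2]. *)
pose e := Num.min e0 8^-1.
have e_gt0 : 0 < e by rewrite lt_min e0_gt0 invr_gt0 ltr0n.
have e_lt : e <= 8^-1 by rewrite ge_min lexx orbT.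
have ee0 : e <= e0 by rewrite ge_min lexx.
have half : 8^-1 < 4^-1 :> R by rewrite ltf_pV2 ?posrE ?ltr0n // ltr_nat.
have half2 : 4^-1 + 4^-1 = 2^-1 :> R by field.
have near_cross h : 0 < h < 2^-1 -> \forall x \near x0, forall t, t \in `[0, 1] ->
    0 < cross (W (t, x)) (rot h (W (t, x0))) /\ 0 < cross (rot (- h) (W (t, x0))) (W (t, x)).
  move=> hI.
  pose P x t := 0 < cross (W (t, x)) (rot h (W (t, x0))) /\
    0 < cross (rot (- h) (W (t, x0))) (W (t, x)).
  have /compact_near_coveringP/(_ X (nbhs x0) P) := @segment_compact R 0 1.
  move=> /(_ _ _); apply => t tI /=.
  pose F1 (tx : R * X) := cross (W tx) (rot h (W (tx.1, x0))).
  pose F2 (tx : R * X) := cross (rot (- h) (W (tx.1, x0))) (W tx).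
  have cW1 : continuous (fun tx : R * X => W (tx.1, x0)).
    move=> tx; apply: (@continuous_comp _ _ _ (fst : R * X -> R) (fun t => W (t, x0))).
      exact: cvg_fst.
    exact: cWx.
  have cF1 : continuous F1 by apply: continuous_cross => //; exact: continuous_rot.
  have cF2 : continuous F2 by apply: continuous_cross => //; exact: continuous_rot.
  have d0 : 0 < dot (W (t, x0)) (W (t, x0)) by apply: dot_gt0; exact: W0.
  have F10 : 0 < F1 (t, x0) by rewrite /F1 cross_rot mulr_gt0 // sin2pi_gt0.
  have F20 : 0 < F2 (t, x0).
    rewrite /F2 (_ : cross _ _ = - cross (W (t, x0)) (rot (- h) (W (t, x0)))).
      by rewrite cross_rot mulrN sinN mulNr opprK mulr_gt0 // sin2pi_gt0.
    by rewrite /cross /=; ring.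
  have N1 := cvgr_gt (F1 (t, x0)) (cF1 (t, x0)) 0 F10.
  have N2 := cvgr_gt (F2 (t, x0)) (cF2 (t, x0)) 0 F20.
  near=> q; split.
    have : 0 < F1 (q.1, q.2) by rewrite -surjective_pairing; near: q; exact: N1.
    by [].
  have : 0 < F2 (q.1, q.2) by rewrite -surjective_pairing; near: q; exact: N2.
  by [].
have [cL0 L00 L0P] := LP x0.
have eI : 0 < e < 2^-1 by rewrite e_gt0; lra.
have Nc := near_cross e eI.
have Na : \forall x \near x0, `|a x0 - a x| < e.
  by move/cvgrPdist_lt: (ca x0); apply.
near=> x.
have [cL L0 LxP] := LP x.
have cr : forall t, t \in `[0, 1] ->
    0 < cross (W (t, x)) (rot e (W (t, x0))) /\ 0 < cross (rot (- e) (W (t, x0))) (W (t, x)).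
  by near: x.
have ax : `|a x0 - a x| < e by near: x.
have rl h : angle_lift (fun t => rot h (W (t, x0))) (a x0 + h)
    (fun t => lift_of (fun t => W (t, x0)) (a x0) t + h).
  split; [move=> t; apply: cvgD; [exact: cL0|exact: cvg_cst]|by rewrite L00|].
  by move=> t tI; apply: has_angle_rot; exact: L0P.
move: ax; rewrite ltr_norml => /andP[ax1 ax2].
have /andP[h1 _] : 0 < lift_of (fun t => W (t, x0)) (a x0) 1 + e -
    lift_of (fun t => W (t, x)) (a x) 1 < 2^-1.
  apply: (angle_lift_sep (LP x) (rl e)).
    by move=> t /cr[c1 _]; rewrite gt_eqF.
  by apply/andP; split; lra.
have /andP[h2 _] : 0 < lift_of (fun t => W (t, x)) (a x) 1 -
    (lift_of (fun t => W (t, x0)) (a x0) 1 - e) < 2^-1.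
  apply: (angle_lift_sep (rl (- e)) (LP x)).
    by move=> t /cr[_ c1]; rewrite gt_eqF.
  by apply/andP; split; lra.
by rewrite ltr_norml; apply/andP; split; lra.
Unshelve. all: by end_near.
Qed.

End lifts.

(** * The annulus, its lifts and its tangent maps *)

Section annulus_maps.
Context {R : realType}.
Implicit Types (f g : annulus R -> annulus R) (F G : plane R -> plane R).
Implicit Types (z : annulus R) (p w : plane R).

Lemma circle_piP (x y : R) : circle_pi x = circle_pi y <-> x - y \is a Num.int.
Proof.
have E : (x - y \is a Num.int) = (x == y %[mod Quotient.quot (int_subgroup R)])%qT.
  by rewrite -Quotient.idealrBE.
by split=> [h|]; [rewrite E; apply/eqP|rewrite E => /eqP].
Qed.

Lemma circle_reprK (c : circle R) : circle_pi (circle_repr c) = c.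
Proof. exact: reprK. Qed.

Lemma continuous_circle_pi : continuous (@circle_pi R).
Proof. exact: pi_continuous. Qed.

Lemma open_circleP (A : set (circle R)) : open A <-> open (circle_pi @^-1` A).
Proof. by []. Qed.

Lemma open_circle_image (A : set R) : open A -> open (circle_pi @` A).
Proof.
move=> oA; apply/open_circleP.
have -> : circle_pi @^-1` (circle_pi @` A) =
    \bigcup_(m : int) ((fun x : R => x + m%:~R) @^-1` A).
  apply/seteqP; split=> x /=.
    case=> y Ay /circle_piP/intrP[m ym]; exists m => //=.
    by rewrite -ym addrC subrK.
  by case=> m _ /= Axm; exists (x + m%:~R) => //; apply/circle_piP; rewrite addrAC subrr add0r intr_int.
apply: bigcup_open => m _; apply: open_comp => // x _.
by apply: cvgD; [exact: cvg_id|exact: cvg_cst].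
Qed.

Lemma annulus_reprK z : annulus_pi (annulus_repr z) = z.
Proof. by case: z => c y; rewrite /annulus_pi /= circle_reprK. Qed.

Lemma annulus_piP p q : annulus_pi p = annulus_pi q <-> p.1 - q.1 \is a Num.int /\ p.2 = q.2.
Proof.
split=> [[/circle_piP ? ?]|[/circle_piP e1 e2]]; first by [].
by rewrite /annulus_pi e1 e2.
Qed.

Lemma continuous_annulus_pi : continuous (@annulus_pi R).
Proof.
apply: continuous_pair.
  apply: (continuousT_comp (continuous_fst (@continuous_idT _)) continuous_circle_pi).
exact: (continuous_snd (@continuous_idT _)).
Qed.

(** The difference of two lifts is continuous with integral first coordinate and
    zero second coordinate. *)
Lemma lift_unique f F G : is_lift f F -> is_lift f G ->
  exists c, forall p, G p = F p + c.
Proof.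
move=> [cF FP] [cG GP]; exists (G 0 - F 0) => p.
have FG q : (G q).1 - (F q).1 \is a Num.int /\ (G q).2 = (F q).2.
  by apply/annulus_piP; rewrite FP GP.
apply: plane_eq => /=; last by rewrite !(FG _).2 subrr addr0.
pose d (t : R) := (G (t *: p)).1 - (F (t *: p)).1.
have cl : continuous (fun t : R => t *: p : plane R).
  by move=> t; apply: cvgZl; exact: cvg_id.
have cd : continuous d.
  by move=> t; apply: cvgB; apply: continuous_fst; apply: continuousT_comp.
have := @int_valued_const R d 0 1 ler01 cd (fun t _ => (FG (t *: p)).1).
by rewrite /d scale0r scale1r /= => ->; rewrite addrC subrK.
Qed.

Lemma diff_translate (F : plane R -> plane R) (c p : plane R) : differentiable F p ->
  differentiable (fun q => F q + c) p /\ forall w, 'd (fun q => F q + c) p w = 'd F p w.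
Proof.
move=> dF; have -> : (fun q => F q + c) = F + cst c by [].
split; first exact: differentiableD.
move=> w.
apply: (etrans (congr1 (@^~ w) (diffD dF (differentiable_cst c p)))).
apply: (etrans (congr1 (fun v => 'd F p w + v) (congr1 (@^~ w) (diff_cst c p)))).
exact: addr0.
Qed.

Lemma diff_precomp_translate (F : plane R -> plane R) (c p : plane R) : differentiable F (p + c) ->
  differentiable (fun q => F (q + c)) p /\ forall w, 'd (fun q => F (q + c)) p w = 'd F (p + c) w.
Proof.
move=> dF; have [d1 d2] := @diff_translate id c p (ex_diff (is_diff_def := is_diff_id p)).
have -> : (fun q => F (q + c)) = F \o (fun q => q + c) by [].
split; first exact: differentiable_comp.
move=> w; apply: (etrans (congr1 (@^~ w) (diff_comp d1 dF))) => /=.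
by apply: congr1; apply: (etrans (d2 w)); exact: (congr1 (@^~ w) (diff_val (is_diff_def := is_diff_id p))).
Qed.

(** Changing the lift, or the point above [z], amounts to adding a constant to [F],
    which does not affect the differential. *)
Lemma annulus_dE f F p w : is_lift f F -> (forall q, differentiable F q) ->
  annulus_d f (annulus_pi p) w = 'd F p w.
Proof.
move=> lF dF; rewrite /annulus_d.
have lG : is_lift f (get (is_lift f)) by exact: getI lF.
set G := get _ in lG *; set p' := annulus_repr _.
clearbody G; have [p1 p2] : p'.1 - p.1 \is a Num.int /\ p'.2 = p.2.
  by apply/annulus_piP; rewrite annulus_reprK.
(* The translation from [p] to the representative chosen by [annulus_repr]. *)
clearbody p'; pose v : plane R := (p'.1 - p.1, 0).
have pv : p' = p + v by apply: plane_eq; rewrite /= ?addr0 // addrC subrK.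
have lGv : is_lift f (fun q => G (q + v)).
  case: lG => cG GP; split.
    apply: continuousT_comp cG => q; apply: cvgD; [exact: cvg_id|exact: cvg_cst].
  move=> q; rewrite GP; congr f; apply/annulus_piP; split=> /=; last by rewrite addr0.
  by rewrite addrAC subrr add0r.
have [c Gc] := lift_unique lF lG.
have dG q : differentiable G q.
  have -> : G = (fun q => F q + c) by apply/funext.
  exact: (diff_translate c (dF q)).1.
have [c' Gc'] := lift_unique lF lGv.
have e1 := (diff_precomp_translate (dG (p + v))).2 w.
have e2 := (diff_translate c' (dF p)).2 w.
have e3 : (fun q => G (q + v)) = (fun q => F q + c') by apply/funext.
clearbody v; subst p'; apply: (etrans (esym e1)).
rewrite e3.
exact: e2.
Qed.

Definition diff_lift f F := is_lift f F /\ forall q, differentiable F q.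

Lemma diff_lift_comp f g F G : diff_lift f F -> diff_lift g G ->
  diff_lift (f \o g) (F \o G).
Proof.
move=> [[cF FP] dF] [[cG GP] dG]; split; last by move=> q; exact: differentiable_comp.
by split=> [|p /=]; [exact: continuousT_comp|rewrite FP GP].
Qed.

Lemma diff_lift_id : diff_lift id id.
Proof. by split=> [|q]; [split=> //; exact: continuous_idT|exact: (ex_diff (is_diff_def := is_diff_id q))]. Qed.

Definition has_diff_lift f := exists F, diff_lift f F.

Lemma diff_lift_get (g : annulus R -> annulus R) :
  has_diff_lift g -> diff_lift g (get (is_lift g)).
Proof.
move=> [F [lF dF]]; have lG : is_lift g (get (is_lift g)) by exact: getI lF.
split=> // q; have [c Gc] := lift_unique lF lG.
have -> : get (is_lift g) = (fun q => F q + c) by apply/funext.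
exact: (diff_translate c (dF q)).1.
Qed.

Lemma has_diff_lift_iter f n : has_diff_lift f -> has_diff_lift (iter n f).
Proof.
move=> [F lF]; elim: n => [|n [G lG]]; first by exists id; exact: diff_lift_id.
by exists (F \o G); exact: (diff_lift_comp lF lG).
Qed.

Lemma annulus_d_comp f g z w : has_diff_lift f -> has_diff_lift g ->
  annulus_d (f \o g) z w = annulus_d f (g z) (annulus_d g z w).
Proof.
move=> [F [lF dF]] [G [lG dG]].
have [lFG dFG] := diff_lift_comp (conj lF dF) (conj lG dG).
rewrite -(annulus_reprK z); set p := annulus_repr z.
rewrite (annulus_dE _ _ lFG dFG) (annulus_dE _ _ lG dG) -(lG.2 p) (annulus_dE _ _ lF dF).
exact: (congr1 (@^~ w) (diff_comp (dG p) (dF (G p)))).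
Qed.

Lemma annulus_d_id z w : annulus_d id z w = w.
Proof.
rewrite -(annulus_reprK z) (annulus_dE _ _ diff_lift_id.1 diff_lift_id.2).
exact: (congr1 (@^~ w) (diff_val (is_diff_def := is_diff_id _))).
Qed.

Lemma annulus_dZ f z (r : R) w : annulus_d f z (r *: w) = r *: annulus_d f z w.
Proof. by rewrite /annulus_d linearZ. Qed.

Lemma annulus_dN f z w : annulus_d f z (- w) = - annulus_d f z w.
Proof. by rewrite /annulus_d linearN. Qed.

Lemma annulus_dB f z u w : annulus_d f z (u - w) = annulus_d f z u - annulus_d f z w.
Proof. by rewrite /annulus_d linearB. Qed.

Lemma annulus_d_basis f z w : annulus_d f z w =
  w.1 *: annulus_d f z (1, 0) + w.2 *: annulus_d f z (0, 1).
Proof.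
rewrite /annulus_d -!linearZ -linearD; congr ('d _ _ _).
by apply: plane_eq; rewrite /= ?fstZ ?sndZ /= -?[_ *: _]/(_ * _) ?mulr0 ?mulr1 ?addr0 ?add0r.
Qed.

Lemma annulus_diffeo1_diff_lift f : annulus_diffeo1 f -> has_diff_lift f.
Proof. by move=> [g [_ _ [F lF [dF _]] _]]; exists F. Qed.

Lemma annulus_d_neq0 f z w : annulus_diffeo1 f -> w != 0 -> annulus_d f z w != 0.
Proof.
move=> [g [fK gK [F lF [dF _]] [G lG [dG _]]]]; apply: contra => /eqP fw.
have : annulus_d (g \o f) z w = 0.
  rewrite annulus_d_comp; [|by exists G|by exists F].
  by rewrite fw -[0 in LHS](scale0r (0 : plane R)) annulus_dZ scale0r.
have -> : g \o f = id by apply/funext.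
by rewrite annulus_d_id => ->.
Qed.

(** The coefficient is that of the orthogonal projection on [u]. *)
Lemma parallel_of_cross0 u w : u != 0 -> cross u w = 0 -> w = (dot u w / dot u u) *: u.
Proof.
move=> u0 c0; have d0 := dot_gt0 u0; rewrite /cross in c0.
have e1 : w.1 * dot u u = dot u w * u.1.
  have -> : w.1 * dot u u = dot u w * u.1 - u.2 * (u.1 * w.2 - u.2 * w.1) by rewrite /dot; ring.
  by rewrite c0 mulr0 subr0.
have e2 : w.2 * dot u u = dot u w * u.2.
  have -> : w.2 * dot u u = dot u w * u.2 + u.1 * (u.1 * w.2 - u.2 * w.1) by rewrite /dot; ring.
  by rewrite c0 mulr0 addr0.
by apply: plane_eq; rewrite ?fstZ ?sndZ mulrAC -?e1 -?e2 mulfK // gt_eqF.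
Qed.

Lemma annulus_d_cross_neq0 f z u w : annulus_diffeo1 f -> cross u w != 0 ->
  cross (annulus_d f z u) (annulus_d f z w) != 0.
Proof.
move=> ff; have [->|u0] := eqVneq u 0; first by rewrite /cross /= !mul0r subrr eqxx.
apply: contra => /eqP/(parallel_of_cross0 (annulus_d_neq0 z ff u0)).
set c := _ / _ => e.
have : annulus_d f z (w - c *: u) = 0 by rewrite annulus_dB annulus_dZ e subrr.
have [|wc] := eqVneq (w - c *: u) 0.
  by move/eqP; rewrite subr_eq0 => /eqP -> _; rewrite -[X in cross X _]scale1r crossZ /cross; apply/eqP; ring.
by move/eqP; rewrite (negPf (annulus_d_neq0 z ff wc)).
Qed.

End annulus_maps.

(** * The action of an isotopy on lifted directions *)

Section isotopy_cocycle.
Context {R : realType} (I : R -> annulus R -> annulus R) (f : annulus R -> annulus R).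
Context (If : isotopy I f).
Implicit Types (z : annulus R) (w : plane R) (a b t : R).

(** The differential of the isotopy, in the standard trivialization; time is clamped
    so that it depends continuously on [t] over the whole line. *)
Definition dI t z w : plane R := annulus_d (I (clamp 0 1 t)) z w.

Lemma isotopy_diffeo t : annulus_diffeo1 (I (clamp 0 1 t)).
Proof. by have [h _ _ _ _] := If; apply: h; exact/clamp_in/ler01. Qed.

Lemma dI0 z w : dI 0 z w = w.
Proof.
have [_ _ _ h _] := If.
have c0 : clamp 0 1 0 = 0 :> R by rewrite clamp_id // in_itv /= ler01 lexx.
by rewrite /dI c0 h annulus_d_id.
Qed.

Lemma dI1 z w : dI 1 z w = annulus_d f z w.
Proof.
have [_ _ _ _ h] := If.
have c1 : clamp 0 1 1 = 1 :> R by rewrite clamp_id // in_itv /= ler01 lexx.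
by rewrite /dI c1 h.
Qed.

Lemma isotopy_end_diffeo : annulus_diffeo1 f.
Proof.
by have [h _ _ _ <-] := If; apply: h; rewrite in_itv /= ler01 lexx.
Qed.

Lemma continuous_isotopy_end : continuous f.
Proof.
have [_ h _ _ <-] := If.
have c1 : continuous (fun z : annulus R => (1 : R, z)).
  exact: continuous_pair (@continuous_cstT _ _ _) (@continuous_idT _).
apply: (continuous_within_comp h c1).
by move=> z; split => //=; rewrite in_itv /= ler01 lexx.
Qed.

Lemma continuous_dI_fixed w : continuous (fun tz : R * annulus R => dI tz.1 tz.2 w).
Proof.
have [_ _ h _ _] := If.
have c1 : continuous (fun tz : R * annulus R => (clamp 0 1 tz.1, tz.2)).
  apply: continuous_pair; last exact: continuous_snd (@continuous_idT _).
  by apply: (continuousT_comp _ (@continuous_clamp R 0 1)); exact: continuous_fst (@continuous_idT _).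
apply: (continuous_within_comp (h w) c1).
by move=> z; split => //=; exact/clamp_in/ler01.
Qed.

(** Joint continuity follows from continuity for fixed vectors, since the
    differential is linear. *)
Lemma continuous_dI (X : topologicalType) (t : X -> R) (z : X -> annulus R) (w : X -> plane R) :
  continuous t -> continuous z -> continuous w -> continuous (fun x => dI (t x) (z x) (w x)).
Proof.
move=> ct cz cw.
have -> : (fun x => dI (t x) (z x) (w x)) = fun x =>
    (w x).1 *: dI (t x) (z x) (1, 0) + (w x).2 *: dI (t x) (z x) (0, 1).
  by apply/funext => x; rewrite {1}/dI annulus_d_basis.
have ctz : continuous (fun x => (t x, z x)) by exact: continuous_pair.
move=> x; apply: cvgD.
  exact: (continuousZ (continuous_fst cw) (continuousT_comp ctz (@continuous_dI_fixed (1, 0)))).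
exact: (continuousZ (continuous_snd cw) (continuousT_comp ctz (@continuous_dI_fixed (0, 1)))).
Qed.

Lemma continuous_dI_path z w : continuous (fun t => dI t z w).
Proof.
apply: continuous_dI; [exact: continuous_idT|exact: continuous_cstT|exact: continuous_cstT].
Qed.

Lemma dI_neq0 t z w : w != 0 -> dI t z w != 0.
Proof. exact/annulus_d_neq0/isotopy_diffeo. Qed.

Lemma dI_cross_neq0 t z u w : cross u w != 0 -> cross (dI t z u) (dI t z w) != 0.
Proof. exact/annulus_d_cross_neq0/isotopy_diffeo. Qed.

Definition turn_lift z a : R -> R := lift_of (fun t => dI t z (dir a)) a.
(** The final angle of the image of a half-line of initial angle [a]. Angles are real
    numbers here, not classes modulo [1]. *)
Definition turn z a : R := turn_lift z a 1.

Lemma turn_liftP z a : angle_lift (fun t => dI t z (dir a)) a (turn_lift z a).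
Proof.
apply: lift_ofP.
- exact: continuous_dI_path.
- by move=> t _; exact/dI_neq0/dir_neq0.
- by rewrite dI0; exact: has_angle_dir.
Qed.

Lemma has_angle_turn z a : has_angle (turn z a) (annulus_d f z (dir a)).
Proof.
have [_ _ h] := turn_liftP z a; rewrite -dI1.
by apply: h; rewrite in_itv /= ler01 lexx.
Qed.

(** Opposite vectors have opposite images, and lifts of the angle are unique. *)
Lemma turnD_half z a : turn z (a + 2^-1) = turn z a + 2^-1.
Proof.
have [cT T0 TP] := turn_liftP z a.
have L : angle_lift (fun t => dI t z (dir (a + 2^-1))) (a + 2^-1) (fun t => turn_lift z a t + 2^-1).
  split; first by move=> t; apply: cvgD; [exact: cT|exact: cvg_cst].
    by rewrite T0.
  move=> t /TP[r r0 e]; exists r => //.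
  by rewrite !dirD_half /dI annulus_dN -/(dI _ _ _) e scalerN.
have := angle_lift_sub (turn_liftP z (a + 2^-1)) L.
move=> /(_ 1); rewrite in_itv /= ler01 lexx subrr => /(_ isT)/eqP.
by rewrite subr_eq0 => /eqP.
Qed.

(** The images of two non-parallel vectors are never parallel. *)
Lemma turn_lt_loc z a b : 0 < b - a < 2^-1 -> turn z a < turn z b.
Proof.
move=> ab; rewrite -subr_gt0.
have cr t : t \in `[0, 1] -> cross (dI t z (dir a)) (dI t z (dir b)) != 0.
  by move=> _; apply: dI_cross_neq0; rewrite cross_dir gt_eqF // sin2pi_gt0.
by have /andP[] := angle_lift_sep (turn_liftP z a) (turn_liftP z b) cr ab.
Qed.

(** An increment of [1/2] or more is cut into steps of length [1/4]. *)
Lemma turn_lt z : {homo turn z : a b / a < b}.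
Proof.
move=> a b ab.
have [n] : exists n, (b - a) * 4 < n%:R by exists (Num.truncn ((b - a) * 4)).+1; exact: truncnS_gt.
elim: n b ab => [|n IH] b ab h; first by move: h; rewrite mulr0n; nra.
have [bs|bs] := ltP (b - a) 2^-1.
  by apply: turn_lt_loc; rewrite bs subr_gt0 ab.
have q4 : 4^-1 * 4 = 1 :> R by rewrite mulVf ?pnatr_eq0.
have q24 : 2^-1 = 4^-1 + 4^-1 :> R by field.
have q0 : 0 < 4^-1 :> R by rewrite invr_gt0 ltr0n.
apply: (@lt_trans _ _ (turn z (b - 4^-1))).
  by apply: IH; [lra|move: h; rewrite -[n.+1%:R]natr1; lra].
by apply: turn_lt_loc; apply/andP; split; lra.
Qed.

Lemma turn_le z : {homo turn z : a b / a <= b}.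
Proof. by move=> a b; rewrite le_eqVlt => /orP[/eqP ->//|/(turn_lt z)/ltW]. Qed.

Lemma continuous_turn : continuous (fun za : annulus R * R => turn za.1 za.2).
Proof.
apply: (@continuous_lift_end R (annulus R * R)%type
  (fun tx => dI tx.1 tx.2.1 (dir tx.2.2)) (fun za => za.2)).
- apply: continuous_dI.
  + exact: continuous_fst (@continuous_idT _).
  + exact: continuous_fst (continuous_snd (@continuous_idT _)).
  + by apply: continuousT_comp continuous_dir; exact: continuous_snd (continuous_snd (@continuous_idT _)).
- exact: continuous_snd (@continuous_idT _).
- by move=> x t _; exact/dI_neq0/dir_neq0.
- by move=> x /=; rewrite dI0; exact: has_angle_dir.
Qed.

Fixpoint turns n z a : R := if n is k.+1 then turn (iter k f z) (turns k z a) else a.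

Lemma turnsD m n z a : turns (m + n) z a = turns m (iter n f z) (turns n z a).
Proof. by elim: m => [|m IH] //=; rewrite IH -iterD. Qed.

Lemma turns_lt n z : {homo turns n z : a b / a < b}.
Proof. by elim: n => [|n IH] a b //= /IH/turn_lt. Qed.

Lemma turns_le n z : {homo turns n z : a b / a <= b}.
Proof. by elim: n => [|n IH] a b //= /IH/turn_le. Qed.

Lemma turnsD_half n z a : turns n z (a + 2^-1) = turns n z a + 2^-1.
Proof. by elim: n => [|n IH] //=; rewrite IH turnD_half. Qed.

Lemma turnsB_halves n k z a : turns n z (a - k%:R / 2) = turns n z a - k%:R / 2.
Proof.
elim: k a => [|k IH] a; first by rewrite mul0r !subr0.
have -> : a - k.+1%:R / 2 = (a - 2^-1) - k%:R / 2 by rewrite -[k.+1%:R]natr1; field.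
by rewrite IH -[in RHS](subrK 2^-1 a) turnsD_half -[k.+1%:R]natr1; field.
Qed.

Lemma continuous_iter n : continuous (iter n f).
Proof.
elim: n => [|n IH]; first exact: continuous_idT.
exact: (continuousT_comp IH continuous_isotopy_end).
Qed.

Lemma continuous_turns n a : continuous (fun z => turns n z a).
Proof.
elim: n => [|n IH] /=; first exact: continuous_cstT.
exact: (continuousT_comp (continuous_pair (@continuous_iter n) IH) continuous_turn).
Qed.

Lemma has_angle_turns n z a : has_angle (turns n z a) (annulus_d (iter n f) z (dir a)).
Proof.
elim: n => [|n [r r0 e]]; first by rewrite annulus_d_id; exact: has_angle_dir.
have hf := annulus_diffeo1_diff_lift isotopy_end_diffeo.
have -> : iter n.+1 f = f \o iter n f by [].
rewrite annulus_d_comp //; last exact: has_diff_lift_iter.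
rewrite e annulus_dZ.
have [s s0 e'] := has_angle_turn (iter n f z) (turns n z a).
by exists (r * s); rewrite ?mulr_gt0 // e' scalerA.
Qed.

End isotopy_cocycle.

(** * Difference quotients extended to a zero increment *)

Section difference_quotients.
Context {R : realType}.

Lemma is_derive_line (F : plane R -> plane R) (p v : plane R) (s : R) :
  differentiable F (p + s *: v) ->
  is_derive s 1 (fun s => (F (p + s *: v)).1) ('d F (p + s *: v) v).1 /\
  is_derive s 1 (fun s => (F (p + s *: v)).2) ('d F (p + s *: v) v).2.
Proof.
move=> dF.
pose a := p + s *: v; pose df := 'd F a v : plane R.
pose q k : plane R := k^-1 *: ((F \o shift a) (k *: v) - F a).
have h : q @ (0:R)^' --> df.
  have := @diff_derivable R _ _ F _ v dF.
  by have /= := @deriveE R _ _ F a v dF; rewrite /derivable /derive /df => <-.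
have E k : p + (k *: (1 : R) + s) *: v = k *: v + a.
  by rewrite -[k *: (1 : R)]/(k * 1) mulr1 scalerDl addrCA.
have h1 : (fun k => (q k).1) @ (0:R)^' --> df.1 := cvg_comp _ _ h (@cvg_fst _ _ _ _ _).
have h2 : (fun k => (q k).2) @ (0:R)^' --> df.2 := cvg_comp _ _ h (@cvg_snd _ _ _ _ _).
pose F1 s := (F (p + s *: v)).1; pose F2 s := (F (p + s *: v)).2.
have E1 : (fun k => k^-1 *: ((F1 \o shift s) (k *: 1) - F1 s)) = fun k => (q k).1.
  by apply/funext => k; rewrite /F1 /= E.
have E2 : (fun k => k^-1 *: ((F2 \o shift s) (k *: 1) - F2 s)) = fun k => (q k).2.
  by apply/funext => k; rewrite /F2 /= E.
split; apply: DeriveDef; rewrite /derivable /derive.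
- by rewrite E1; apply/cvg_ex; exists df.1; exact: h1.
- by rewrite E1; apply: cvg_lim => //; exact: h1.
- by rewrite E2; apply/cvg_ex; exists df.2; exact: h2.
- by rewrite E2; apply: cvg_lim => //; exact: h2.
Qed.

(** [H t] vanishes at [0] and has derivative [g t]: this is [H t s / s], extended by
    its limit at [s = 0]. *)
Definition diff_quotient (g H : R -> R -> R) (ts : R * R) : R :=
  if ts.2 == 0 then g ts.1 0 else H ts.1 ts.2 / ts.2.

(** The value at [(t, s)] is the increment over [[0, 1]] of a function of [u] with
    derivative [g t (s u)]. By the mean value theorem, two values differ by at
    most the supremum over [u] of the difference of these derivatives, which is
    small by compactness of [[0, 1]]. *)
Lemma continuous_diff_quotient (g H : R -> R -> R) :
  continuous (fun ts : R * R => g ts.1 ts.2) ->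
  (forall t s : R, is_derive s (1 : R) (H t) (g t s)) -> (forall t, H t 0 = 0) ->
  continuous (diff_quotient g H).
Proof.
move=> cg dH H0.
(* For [q.2 = 0] the linear function with slope [g q.1 0], so that the derivative has the
   same expression in both cases. *)
pose phi (q : R * R) (u : R) := if q.2 == 0 then g q.1 0 * u else (q.2)^-1 * H q.1 (q.2 * u).
have dphi q (u : R) : is_derive u (1 : R) (phi q) (g q.1 (q.2 * u)).
  rewrite /phi; case: eqP => [->|/eqP q0].
    rewrite mul0r; apply: is_derive_eq.
    by rewrite /GRing.scale /= mulr1.
  have d1 : is_derive u (1 : R) (fun u => q.2 * u) q.2.
    apply: is_derive_eq; by rewrite /GRing.scale /= mulr1.
  have d2 := is_derive1_comp (dH q.1 (q.2 * u)) d1.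
  have d3 := is_deriveZ (q.2)^-1 d2.
  have <- : (q.2)^-1 * (g q.1 (q.2 * u) * q.2) = g q.1 (q.2 * u) by rewrite mulrCA mulVf // mulr1.
  exact: d3.
have phi0 q : phi q 0 = 0 by rewrite /phi; case: ifP; rewrite !mulr0 ?H0 ?mulr0.
have phi1 q : phi q 1 = diff_quotient g H q.
  by rewrite /phi /diff_quotient; case: ifP; rewrite mulr1 // mulrC.
move=> q0; apply/cvgrPdist_lt => e e0.
have N : \forall q \near q0, forall u, u \in `[0, 1] -> `|g q0.1 (q0.2 * u) - g q.1 (q.2 * u)| < e.
  pose P (q : R * R) u := `|g q0.1 (q0.2 * u) - g q.1 (q.2 * u)| < e.
  have /compact_near_coveringP/(_ _ (nbhs q0) P) := @segment_compact R 0 1.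
  move=> /(_ _ _); apply => u uI /=.
  pose A (uq : R * (R * R)) := `|g q0.1 (q0.2 * uq.1) - g uq.2.1 (uq.2.2 * uq.1)|.
  have cu : continuous (fun uq : R * (R * R) => uq.1) := continuous_fst (@continuous_idT _).
  have cq : continuous (fun uq : R * (R * R) => uq.2) := continuous_snd (@continuous_idT _).
  have c1 : continuous (fun uq : R * (R * R) => g q0.1 (q0.2 * uq.1)).
    apply: (continuousT_comp (h := fun uq : R * (R * R) => (q0.1, q0.2 * uq.1)) _ cg).
    apply: continuous_pair; first exact: continuous_cstT.
    by move=> x; apply: cvgM; [exact: cvg_cst|exact: cu].
  have c2 : continuous (fun uq : R * (R * R) => g uq.2.1 (uq.2.2 * uq.1)).
    apply: (continuousT_comp (h := fun uq : R * (R * R) => (uq.2.1, uq.2.2 * uq.1)) _ cg).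
    apply: continuous_pair; first exact: continuous_fst.
    by move=> x; apply: cvgM; [exact: (continuous_snd cq)|exact: cu].
  have cA : continuous A by move=> x; apply: cvg_norm; apply: cvgB; [exact: c1|exact: c2].
  have A0 : A (u, q0) < e by rewrite /A /= subrr normr0.
  have N := cvgr_lt (A (u, q0)) (cA (u, q0)) e A0.
  near=> uq; have : A (uq.1, uq.2) < e by rewrite -surjective_pairing; near: uq; exact: N.
  by [].
near=> q; rewrite -!phi1.
have dd x : is_derive x (1 : R) (fun u => phi q0 u - phi q u) (g q0.1 (q0.2 * x) - g q.1 (q.2 * x)).
  exact: is_deriveB (dphi q0 x) (dphi q x).
have cc : continuous (fun u => phi q0 u - phi q u).
  move=> x; apply: differentiable_continuous; apply/derivable1_diffP.
  exact: (@ex_derive _ _ _ _ _ _ _ (dd x)).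
have [c cI] := MVT ltr01 (fun x _ => dd x) (continuous_subspaceT cc).
rewrite !phi0 subrr !subr0 mulr1 => ->.
have : forall u, u \in `[0, 1] -> `|g q0.1 (q0.2 * u) - g q.1 (q.2 * u)| < e by near: q; exact: N.
by apply; move: cI; rewrite !in_itv /= => /andP[/ltW -> /ltW ->].
Unshelve. all: by end_near.
Qed.

End difference_quotients.

(** * Rotation of the secants of a horizontal circle *)

Section twist_bound.
Context {R : realType} (I : R -> annulus R -> annulus R) (f : annulus R -> annulus R).
Context (If : isotopy I f).
Implicit Types (p w : plane R) (t s a b : R).

(** The lifts are chosen independently for each time. As two lifts differ by a
    constant horizontal vector, neither the increments of a lift nor its second
    coordinate depend on the choice. *)
Definition isotopy_lift t : plane R -> plane R := get (is_lift (I (clamp 0 1 t))).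

Lemma isotopy_lift_diff t : diff_lift (I (clamp 0 1 t)) (isotopy_lift t).
Proof. exact/diff_lift_get/annulus_diffeo1_diff_lift/(isotopy_diffeo If). Qed.

Definition horizontal : plane R := (1, 0).

Lemma dI_isotopy_lift t p w : dI I t (annulus_pi p) w = 'd (isotopy_lift t) p w.
Proof. by have [l d] := isotopy_lift_diff t; exact: annulus_dE. Qed.

(** The vector [(F_t (p + s e) - F_t p) / s] for [e] horizontal, extended to [s = 0]
    by the image of [e] under the differential. *)
Definition secant p (ts : R * R) : plane R :=
  (diff_quotient (fun t s => (dI I t (annulus_pi (p + s *: horizontal)) horizontal).1)
          (fun t s => (isotopy_lift t (p + s *: horizontal)).1 - (isotopy_lift t p).1) ts,
   diff_quotient (fun t s => (dI I t (annulus_pi (p + s *: horizontal)) horizontal).2)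
          (fun t s => (isotopy_lift t (p + s *: horizontal)).2 - (isotopy_lift t p).2) ts).

Lemma continuous_secant p : continuous (secant p).
Proof.
have cp : continuous (fun ts : R * R => annulus_pi (p + ts.2 *: horizontal)).
  apply: continuousT_comp (@continuous_annulus_pi R) => ts.
  apply: cvgD; first exact: cvg_cst.
  by apply: cvgZl; exact: cvg_snd.
have cd : continuous (fun ts : R * R => dI I ts.1 (annulus_pi (p + ts.2 *: horizontal)) horizontal).
  by apply: (continuous_dI If); [exact: continuous_fst (@continuous_idT _)|exact: cp|exact: continuous_cstT].
apply: continuous_pair; apply: continuous_diff_quotient.
- exact: (continuous_fst cd).
- move=> t s; rewrite dI_isotopy_lift.
  have [h _] := is_derive_line ((isotopy_lift_diff t).2 (p + s *: horizontal)).
  by have := is_deriveB h (is_derive_cst (isotopy_lift t p).1 s 1); rewrite subr0.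
- by move=> t; rewrite scale0r addr0 subrr.
- exact: (continuous_snd cd).
- move=> t s; rewrite dI_isotopy_lift.
  have [_ h] := is_derive_line ((isotopy_lift_diff t).2 (p + s *: horizontal)).
  by have := is_deriveB h (is_derive_cst (isotopy_lift t p).2 s 1); rewrite subr0.
- by move=> t; rewrite scale0r addr0 subrr.
Qed.

Lemma secant0 p t : secant p (t, 0) = dI I t (annulus_pi p) horizontal.
Proof. by rewrite /secant /diff_quotient /= eqxx !scale0r !addr0 -surjective_pairing. Qed.

Lemma secantE p t s : s != 0 ->
  secant p (t, s) = s^-1 *: (isotopy_lift t (p + s *: horizontal) - isotopy_lift t p).
Proof.
move=> /negPf s0; rewrite /secant /diff_quotient /= s0.
by apply: plane_eq; rewrite ?fstZ ?sndZ /= mulrC.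
Qed.

Lemma annulus_pi_horizontal p s : annulus_pi (p + s *: horizontal) = annulus_pi p <-> s \is a Num.int.
Proof.
rewrite annulus_piP /= -![_ *: _]/(_ * _) mulr1 mulr0 addr0 addrAC subrr add0r.
by split=> [[]|].
Qed.

(** At time [0] the lift is a translation. *)
Lemma secant_start p s : secant p (0, s) = horizontal.
Proof.
have [->|s0] := eqVneq s 0; first by rewrite secant0 (dI0 If).
rewrite secantE //.
have [l0 _] := isotopy_lift_diff 0.
have c0 : clamp 0 1 0 = 0 :> R by rewrite clamp_id // in_itv /= ler01 lexx.
have I0 : I 0 = id by have [_ _ _ ? _] := If.
rewrite c0 I0 in l0.
have [c E] := lift_unique diff_lift_id.1 l0.
have -> : isotopy_lift 0 = (fun q => q + c) by apply/funext.
rewrite opprD addrACA subrr addr0 addrAC subrr add0r scalerA mulVf //.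
by rewrite scale1r.
Qed.

(** Translation by [1] in the horizontal direction is a deck transformation, so at
    [s = 1] the increment is an integral horizontal vector; it depends
    continuously on time. *)
Lemma secant_end p t : secant p (t, 1) = horizontal.
Proof.
pose d t := secant p (t, 1).
have dE u : d u = isotopy_lift u (p + 1 *: horizontal) - isotopy_lift u p.
  by rewrite /d secantE ?oner_eq0 // invr1 scale1r.
have di u : (d u).1 \is a Num.int /\ (d u).2 = 0.
  have [lu _] := isotopy_lift_diff u.
  have /annulus_piP[h1 h2] : annulus_pi (isotopy_lift u (p + 1 *: horizontal)) = annulus_pi (isotopy_lift u p).
    by rewrite !lu.2; congr (I _); apply/annulus_pi_horizontal; exact: int_num1.
  by rewrite dE /= h2 subrr.
have cd : continuous (fun u => (d u).1).
  have c2 : continuous (fun u : R => (u, 1 : R)).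
    exact: continuous_pair (@continuous_idT _) (@continuous_cstT _ _ _).
  exact: continuous_fst (continuousT_comp c2 (@continuous_secant p)).
have d0 : d 0 = horizontal by exact: secant_start.
rewrite -/(d t); apply: plane_eq; last by rewrite (di t).2.
rewrite -d0; case: (leP 0 t) => t0.
  by symmetry; apply: int_valued_const t0 cd _ => u _; exact: (di u).1.
by apply: int_valued_const (ltW t0) cd _ => u _; exact: (di u).1.
Qed.

(** A zero would contradict injectivity of the isotopy for [0 < s < 1], and that of
    its differential for [s = 0]. *)
Lemma secant_neq0 p t s : s \in `[0, 1] -> secant p (t, s) != 0.
Proof.
rewrite in_itv /= => /andP[s0 s1].
have h0 : horizontal != 0 by apply/eqP => -[/eqP]; rewrite oner_eq0.
have [->|s0'] := eqVneq s 0; first by rewrite secant0; exact: (dI_neq0 If).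
have [->|s1'] := eqVneq s 1; first by rewrite secant_end.
rewrite secantE // scaler_eq0 invr_eq0 (negPf s0') /=.
apply/eqP => /eqP; rewrite subr_eq0 => /eqP e.
have [[_ l] _] := isotopy_lift_diff t.
have := l (p + s *: horizontal); rewrite e l.
have [g [gK _ _ _]] := isotopy_diffeo If t.
move=> /(can_inj gK)/esym/annulus_pi_horizontal/intrP[m sm].
move: s0 s1 s0' s1'; rewrite sm ler0z -[1]/(1%:~R) ler_int eqr_int intr_eq0; lia.
Qed.

Lemma dir_horizontal : dir (- 4^-1) = horizontal.
Proof.
rewrite /dir (_ : 2 * pi * (- 4^-1) = - (pi / 2)); last by field.
by rewrite sinN cosN sin_pihalf cos_pihalf opprK.
Qed.

(** The final angle of the path [t |-> secant p (t, s)] is a continuous function of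
    [s]. It is [-1/4] for [s = 1], where the path is constant, and it is
    [turn (-1/4)] for [s = 0]. If the direction of angle [c] is never met at time
    [1], both values are on the same side of [c]. *)
Lemma turn_quarter_bound p c :
  (forall s, s \in `[0, 1] -> ~ has_angle c (secant p (1, s))) ->
  (- 4^-1 < c -> turn I (annulus_pi p) (- 4^-1) < c) /\
  (c < - 4^-1 -> c < turn I (annulus_pi p) (- 4^-1)).
Proof.
move=> hc.
(* The parameter is reversed, so that the constant path comes first. *)
pose W (ts : R * R) := secant p (ts.1, clamp 0 1 (1 - ts.2)).
have cl s : clamp 0 1 s \in `[0, 1] :> bool by exact/clamp_in/ler01.
have c1s : continuous (fun s : R => clamp 0 1 (1 - s)).
  apply: (continuousT_comp _ (@continuous_clamp R 0 1)) => s.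
  by apply: cvgB; [exact: cvg_cst|exact: cvg_id].
have cW : continuous W.
  have c2 : continuous (fun ts : R * R => (ts.1, clamp 0 1 (1 - ts.2))).
    apply: continuous_pair; first exact: continuous_fst (@continuous_idT _).
    by apply: (continuousT_comp _ c1s); exact: continuous_snd (@continuous_idT _).
  exact: continuousT_comp c2 (@continuous_secant p).
have W0 s t : t \in `[0, 1] -> W (t, s) != 0 by move=> _; exact: secant_neq0.
have aW s : has_angle (- 4^-1) (W (0, s)).
  by rewrite /W secant_start -dir_horizontal; exact: has_angle_dir.
pose th s := lift_of (fun t => W (t, s)) (- 4^-1) 1.
have cth : continuous th.
  by apply: (@continuous_lift_end R R W (fun=> - 4^-1)) => //; exact: continuous_cstT.
have cWs s : continuous (fun t => W (t, s)).
  have c2 : continuous (fun t : R => (t, s)).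
    exact: continuous_pair (@continuous_idT _) (@continuous_cstT _ _ _).
  exact: continuousT_comp c2 cW.
have LP s := lift_ofP (cWs s) (W0 s) (aW s).
have i1 : (1 : R) \in `[0, 1] by rewrite in_itv /= ler01 lexx.
have i0 : (0 : R) \in `[0, 1] by rewrite in_itv /= ler01 lexx.
have th0 : th 0 = - 4^-1.
  have L : angle_lift (fun t => W (t, 0)) (- 4^-1) (fun=> - 4^-1).
    split=> //; first exact: continuous_cstT.
    by move=> t _; rewrite /W /= subr0 clamp_id // secant_end -dir_horizontal; exact: has_angle_dir.
  have := angle_lift_sub (LP 0) L i1; rewrite subrr => /eqP.
  by rewrite subr_eq0 => /eqP.
have th1 : th 1 = turn I (annulus_pi p) (- 4^-1).
  rewrite /th /turn /turn_lift; congr (lift_of _ _ _); apply/funext => t.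
  by rewrite /W /= subrr clamp_id // secant0 dir_horizontal.
have av s : s \in `[0, 1] -> th s != c.
  move=> sI; apply/eqP => e; apply: (hc (clamp 0 1 (1 - s))); first exact: cl.
  by rewrite -e; have [_ _ h] := LP s; exact: h.
rewrite -th1 -th0; split=> h.
  exact: (avoid_lt ler01 cth h av).
exact: (avoid_gt ler01 cth h av).
Qed.

End twist_bound.

(** * The rotation of the vertical direction under a twist map *)

Section twist_range.
Context {R : realType} (I : R -> annulus R -> annulus R) (f : annulus R -> annulus R).
Context (If : isotopy I f).
Implicit Types (p w : plane R) (t s a b : R).

Local Notation height x y := ((I (clamp 0 1 1) (circle_pi x, y)).2).

Let heightE x y : (isotopy_lift I 1 (x, y)).2 = height x y.
Proof. by have [[_ l] _] := isotopy_lift_diff If 1; have := l (x, y) => /(congr1 snd). Qed.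

Let height_line x y s : (isotopy_lift I 1 ((x, y) + s *: horizontal)).2 = height (x + s) y.
Proof.
rewrite -heightE; congr (snd (isotopy_lift I 1 _)); apply: plane_eq => /=.
  by rewrite -[s *: 1]/(s * 1) mulr1.
by rewrite -[s *: 0]/(s * 0) mulr0 addr0.
Qed.

Lemma continuous_height y : continuous (fun x => height x y).
Proof.
apply: continuous_snd; apply: (continuousT_comp (h := fun x => (circle_pi x, y)) (k := I (clamp 0 1 1))).
  apply: continuous_pair; [exact: continuous_circle_pi|exact: continuous_cstT].
by have [_ _ _ _ e] := If; rewrite clamp011 e; exact: continuous_isotopy_end If.
Qed.

(** The height depends only on the class of [x] modulo [1]. *)
Lemma height_mod1 x y : exists2 x', x' \in `[0, 1] & height x' y = height x y.
Proof.
exists (x - (Num.floor x)%:~R).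
  have := floor_itv x; rewrite intrD in_itv /= => /andP[h1 h2].
  by apply/andP; split; lra.
have -> // : circle_pi (x - (Num.floor x)%:~R) = circle_pi x.
by apply/circle_piP; rewrite addrAC subrr add0r rpredN intr_int.
Qed.

Lemma height_max y : exists x, forall x', height x' y <= height x y.
Proof.
have [c _ cP] := EVT_max ler01 (continuous_subspaceT (@continuous_height y)).
by exists c => x'; have [x'' x''I <-] := height_mod1 x' y; exact: cP.
Qed.

Lemma height_min y : exists x, forall x', height x y <= height x' y.
Proof.
have [c _ cP] := EVT_min ler01 (continuous_subspaceT (@continuous_height y)).
by exists c => x'; have [x'' x''I <-] := height_mod1 x' y; exact: cP.
Qed.

Let height_derive (x y : R) : is_derive (0 : R) (1 : R) (fun s => height (x + s) y)
  (secant I (x, y) (1, 0)).2.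
Proof.
have [_ d] := is_derive_line ((isotopy_lift_diff If 1).2 ((x, y) + 0 *: horizontal)).
rewrite secant0 (dI_isotopy_lift If).
have -> : (fun s => height (x + s) y) = (fun s => (isotopy_lift I 1 ((x, y) + s *: horizontal)).2).
  by apply/funext => s; rewrite height_line.
by rewrite -[X in 'd _ X](addr0 (x, y)) -[X in _ + X](scale0r horizontal).
Qed.

Let secant2 x y s : s != 0 ->
  (secant I (x, y) (1, s)).2 = s^-1 * (height (x + s) y - height x y).
Proof. by move=> s0; rewrite secantE // sndZ /= height_line heightE. Qed.

Let height_derivable x y t : derivable (fun s => height (x + s) y) t 1.
Proof.
have [_ d] := is_derive_line ((isotopy_lift_diff If 1).2 ((x, y) + t *: horizontal)).
have -> : (fun s => height (x + s) y) = (fun s => (isotopy_lift I 1 ((x, y) + s *: horizontal)).2).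
  by apply/funext => u; rewrite height_line.
exact: (@ex_derive _ _ _ _ _ _ _ d).
Qed.

Let N11 : -1 <= 1 :> R. Proof. by rewrite (le_trans (lerN10 _)) ?ler01. Qed.
Let N101 : (0 : R) \in `](-1), 1[. Proof. by rewrite in_itv /= ltrN10 ltr01. Qed.

(** For [s > 0] the secant compares the height with its maximum; for [s = 0] its
    vertical component is the derivative of the height, which vanishes. *)
Lemma secant_max x y s : (forall x', height x' y <= height x y) ->
  s \in `[0, 1] -> (secant I (x, y) (1, s)).2 <= 0.
Proof.
move=> hx sI; have /andP[s0 s1] : 0 <= s <= 1 by move: sI; rewrite in_itv.
have [->|s0'] := eqVneq s 0.
  have d1 := height_derive x y.
  have d2 : is_derive (0 : R) (1 : R) (fun s => height (x + s) y) 0.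
    have hx0 t : t \in `](-1), 1[ -> height (x + t) y <= height (x + 0) y by rewrite addr0.
    exact: (derive1_at_max N11 (fun t _ => @height_derivable x y t) N101 hx0).
  by rewrite -(@derive_val _ _ _ _ _ _ _ d1) (@derive_val _ _ _ _ _ _ _ d2).
rewrite secant2 // pmulr_rle0 ?subr_le0 // invr_gt0.
by rewrite lt_neqAle eq_sym s0'.
Qed.

Lemma secant_min x y s : (forall x', height x y <= height x' y) ->
  s \in `[0, 1] -> 0 <= (secant I (x, y) (1, s)).2.
Proof.
move=> hx sI; have /andP[s0 s1] : 0 <= s <= 1 by move: sI; rewrite in_itv.
have [->|s0'] := eqVneq s 0.
  have d1 := height_derive x y.
  have d2 : is_derive (0 : R) (1 : R) (fun s => height (x + s) y) 0.
    have hx0 t : t \in `](-1), 1[ -> height (x + t) y >= height (x + 0) y by rewrite addr0.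
    exact: (derive1_at_min N11 (fun t _ => @height_derivable x y t) N101 hx0).
  by rewrite -(@derive_val _ _ _ _ _ _ _ d1) (@derive_val _ _ _ _ _ _ _ d2).
rewrite secant2 // mulr_ge0 ?subr_ge0 // invr_ge0 //.
Qed.

Lemma dir0 : dir 0 = vertical :> plane R.
Proof. by rewrite /dir mulr0 sin0 cos0 oppr0. Qed.

Lemma dirN_half : dir (- 2^-1) = - vertical :> plane R.
Proof.
rewrite -[LHS]opprK -dirD_half addNr dir0 //.
Qed.

Lemma quarter_half : - 4^-1 + 2^-1 = 4^-1 :> R. Proof. by field. Qed.

(** At a maximum of the height, the secants at time [1] never point straight up,
    whence [turn (-1/4) < 0]; monotonicity and commutation with half turns pass
    from the horizontal to the vertical vector. *)
Lemma turn_max_lt p : (forall x', height x' p.2 <= height p.1 p.2) ->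
  turn I (annulus_pi p) 0 < 2^-1.
Proof.
case: p => x y /= hx.
have [|h _] := @turn_quarter_bound _ I f If (x, y) 0.
  move=> s sI [r r0]; rewrite dir0 => e.
  have := secant_max hx sI; rewrite e sndZ /= mulr1.
  by rewrite leNgt r0.
have q0 : 0 < 4^-1 :> R by rewrite invr_gt0 ltr0n.
apply: (lt_trans (turn_lt If _ q0)); rewrite -quarter_half (turnD_half If).
by have := h; rewrite oppr_lt0 => /(_ q0); lra.
Qed.

(** Symmetrically, at a minimum the secants never point straight down, whence
    [turn (-1/4) > -1/2]. *)
Lemma turn_min_gt p : (forall x', height p.1 p.2 <= height x' p.2) ->
  - 2^-1 < turn I (annulus_pi p) 0.
Proof.
case: p => x y /= hx.
have [|_ h] := @turn_quarter_bound _ I f If (x, y) (- 2^-1).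
  move=> s sI [r r0]; rewrite dirN_half => e.
  have := secant_min hx sI; rewrite e sndZ /= mulrN mulr1.
  by rewrite oppr_ge0 leNgt r0.
have q0 : 0 < 4^-1 :> R by rewrite invr_gt0 ltr0n.
have e := quarter_half.
apply: (lt_trans (h _)); first by lra.
by apply: (turn_lt If); lra.
Qed.

(** The derivative of an increasing diffeomorphism is nonnegative, and the chain rule
    with the inverse shows that it does not vanish. *)
Lemma twist_derivative_gt0 z : positive_twist f -> 0 < (annulus_d f z vertical).1.
Proof.
move=> [ff _ tw].
have [F [lF dF]] := annulus_diffeo1_diff_lift ff.
rewrite -(annulus_reprK z) (annulus_dE _ _ lF dF).
case: (annulus_repr z) => x y.
have [hm [k [hk kh [dh _] [dk _]]]] := tw F lF x.
set h := (fun y => _) in hm hk kh dh.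
have L s : (x, 0) + s *: vertical = (x, s) :> plane R.
  apply: plane_eq => /=; first by rewrite -[s *: 0]/(s * 0) mulr0 addr0.
  by rewrite -[s *: 1]/(s * 1) mulr1 add0r.
have [d _] := is_derive_line (dF ((x, 0) + y *: vertical)).
have E : (fun s => (F ((x, 0) + s *: vertical)).1) = h.
  by apply/funext => s; rewrite L.
rewrite E L in d.
set c := (_).1 in d *.
have c0 : 0 <= c.
  have := @incr_derive1_ge0 R h setT y; rewrite interiorT derive1E (@derive_val _ _ _ _ _ _ _ d).
  apply=> //; first by move=> u _; apply/derivable1_diffP; exact: dh.
  by move=> u v _ _; exact: hm.
rewrite lt_neqAle c0 andbT eq_sym; apply/eqP => cE.
have dk1 : is_derive (h y) (1 : R) k ('D_1 k (h y)).
  by apply: DeriveDef => //; apply/derivable1_diffP; exact: dk.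
have := is_derive1_comp dk1 d.
have -> : k \o h = id by apply/funext => u /=; rewrite hk.
rewrite cE mulr0 => /(@derive_val _ _ _ _ _ _ _); rewrite derive_id => /eqP.
by rewrite oner_eq0.
Qed.

Lemma turn_avoid z (c : R) : positive_twist f -> sin (2 * pi * c) = 0 -> turn I z 0 != c.
Proof.
move=> /(twist_derivative_gt0 z) + s0; apply: contraTneq => e.
have [r r0] := has_angle_turn If z 0; rewrite dir0 => ->.
by rewrite fstZ /dir e s0 /= oppr0 mulr0 ltxx.
Qed.

Lemma turn_sin z : positive_twist f -> sin (2 * pi * turn I z 0) < 0.
Proof.
move=> /(twist_derivative_gt0 z).
have [r r0] := has_angle_turn If z 0; rewrite dir0 => ->.
by rewrite fstZ /dir /= pmulr_rgt0 // oppr_gt0.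
Qed.

(** Along the circle [y = cst], the continuous function [turn z 0] avoids [-1/2] and
    [0], since the image of the vertical is never vertical; it is below [0] at
    a maximum of the height and above [-1/2] at a minimum. *)
Lemma turn_range z : positive_twist f -> - 2^-1 < turn I z 0 < 0.
Proof.
move=> ft.
rewrite -(annulus_reprK z); case: (annulus_repr z) => x y.
pose g x0 s := turn I (annulus_pi (x0 + s * (x - x0), y)) 0.
have cg x0 : continuous (g x0).
  have c1 : continuous (fun s : R => annulus_pi (x0 + s * (x - x0), y)).
    apply: continuousT_comp (@continuous_annulus_pi R).
    apply: continuous_pair; last exact: continuous_cstT.
    move=> s; apply: cvgD; first exact: cvg_cst.
    by apply: cvgM; [exact: cvg_id|exact: cvg_cst].
  exact: (continuousT_comp (continuous_pair c1 (@continuous_cstT _ _ 0)) (continuous_turn If)).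
have g0 x0 : g x0 0 = turn I (annulus_pi (x0, y)) 0 by rewrite /g mul0r addr0.
have g1 x0 : g x0 1 = turn I (annulus_pi (x, y)) 0 by rewrite /g mul1r addrC subrK.
have h0 : 0 < 2^-1 :> R by rewrite invr_gt0 ltr0n.
apply/andP; split.
  have [x0 hx] := height_min y.
  rewrite -(g1 x0); apply: (avoid_gt ler01 (cg x0)); first by rewrite g0; exact: (turn_min_gt (p := (x0, y))).
  by move=> t _; apply: (turn_avoid _ ft); rewrite mulrN sinN sin_half oppr0.
have [x0 hx] := height_max y.
rewrite -(g1 x0); apply: (avoid_lt ler01 (cg x0)); last first.
  by move=> t _; apply: (turn_avoid _ ft); rewrite mulr0 sin0.
rewrite g0 ltNge; apply/negP => h.
have := turn_sin (annulus_pi (x0, y)) ft; apply/negP; rewrite -leNgt.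
have := h; rewrite le_eqVlt => /orP[/eqP <-|h']; first by rewrite mulr0 sin0.
by apply/ltW/sin2pi_gt0; rewrite h' (turn_max_lt (p := (x0, y))).
Qed.

End twist_range.

(** * The integral of the angle form along the tangent orbit *)

Section torsion.
Context {R : realType} (I : R -> annulus R -> annulus R) (f : annulus R -> annulus R).
Context (If : isotopy I f).
Implicit Types (p w : plane R) (t s a b : R) (z : annulus R).

Lemma theta_has_angle z w a : has_angle a w -> theta (z, w) = circle_pi a.
Proof.
move=> aw; rewrite /theta /oriented_angle /=.
have rotE s : rotate (2 * pi * s) vertical = dir s.
  by rewrite /rotate /dir /= !mulr0 !mulr1 !add0r.
set S := [set _ | _].
have : S (circle_pi a) by have [r r0 e] := aw; exists a, r; rewrite rotE.
move/(@getI _ S) => [s [r [-> r0 e]]].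
by apply/circle_piP; apply: (@has_angle_int _ _ _ w) => //; exists r; rewrite // -rotE.
Qed.

(** The lift [T] is only compared with another continuous determination, from which
    it differs by an integer-valued continuous function. *)
Lemma int_dthetaE (gamma : R -> annulus R * plane R) (T : R -> R) :
  continuous T ->
  (forall t, t \in `[0, 1] -> has_angle (T t) (gamma t).2) ->
  int_dtheta gamma = T 1 - T 0.
Proof.
move=> cT hT; rewrite /int_dtheta; set S := [set _ | _].
have thE t : t \in `[0, 1] -> theta (gamma t) = circle_pi (T t).
  by move=> tI; rewrite [gamma t]surjective_pairing; apply: theta_has_angle; exact: hT.
have : S (T 1 - T 0).
  exists T; split=> //; first exact: continuous_subspaceT.
  by move=> t /thE.
move/(@getI _ S); move: (get S) => _ [T' [cT' hT' ->]].
have cl : forall t : R, clamp 0 1 t \in `[0, 1] by move=> t; exact/clamp_in/ler01.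
have cc : continuous (fun t => T' (clamp 0 1 t)).
  by apply: (continuous_within_comp cT' (@continuous_clamp R 0 1)) => t /=; exact: cl.
have cTc : continuous (fun t => T (clamp 0 1 t)) := continuousT_comp (@continuous_clamp R 0 1) cT.
have c0 : clamp 0 1 0 = 0 :> R by rewrite clamp_id // in_itv /= ler01 lexx.
have cd : continuous (fun t => T' (clamp 0 1 t) - T (clamp 0 1 t)).
  by move=> t; apply: cvgB; [exact: cc|exact: cTc].
have : T' (clamp 0 1 0) - T (clamp 0 1 0) = T' (clamp 0 1 1) - T (clamp 0 1 1).
  apply: (int_valued_const ler01 cd) => t _; apply/circle_piP.
  by rewrite hT' ?thE.
by rewrite c0 clamp011; lra.
Qed.

(** The continuous angle at time [u], glued from the lifts over the successive
    iterates: the [k]-th summand runs over its full course while [u] goes from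
    [k] to [k + 1] and is constant otherwise, so that the sum is visibly
    continuous in [u]. *)
Fixpoint turns_lift m z a (u : R) : R := if m is k.+1 then
  turns_lift k z a u + (turn_lift I (iter k f z) (turns I f k z a) (clamp 0 1 (u - k%:R))
    - turns I f k z a) else a.

Lemma continuous_turns_lift m z a : continuous (turns_lift m z a).
Proof.
elim: m => [|m IH] /=; first exact: continuous_cstT.
move=> u; apply: cvgD; first exact: IH.
apply: cvgB; last exact: cvg_cst.
have [cT _ _] := turn_liftP If (iter m f z) (turns I f m z a).
have c1 : continuous (fun u : R => clamp 0 1 (u - m%:R)).
  apply: (continuousT_comp _ (@continuous_clamp R 0 1)) => v.
  by apply: cvgB; [exact: cvg_id|exact: cvg_cst].
exact: (continuousT_comp c1 cT).
Qed.

Lemma turns_lift_before m z a u : m%:R <= u -> turns_lift m z a u = turns I f m z a.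
Proof.
elim: m => [//|m IH] mu /=.
have m1 : m%:R + 1 <= u by rewrite natr1.
rewrite IH; last by lra.
have -> : clamp 0 1 (u - m%:R) = 1 by rewrite /clamp min_r ?max_r ?ler01 //; lra.
by rewrite addrC subrK.
Qed.

Lemma turns_lift_at k m z a u : (k < m)%N -> k%:R <= u <= k.+1%:R ->
  turns_lift m z a u = turn_lift I (iter k f z) (turns I f k z a) (u - k%:R).
Proof.
rewrite -natr1 => + /andP[ku uk]; elim: m => [//|m IH]; rewrite ltnS leq_eqVlt => /orP[/eqP <-|km] /=.
  rewrite turns_lift_before // clamp_id; last by rewrite in_itv /=; apply/andP; split; lra.
  by rewrite addrC subrK.
have m1 : k%:R + 1 <= m%:R :> R by rewrite natr1 ler_nat.
rewrite IH //.
have -> : clamp 0 1 (u - m%:R) = 0 by rewrite /clamp min_l ?max_l //; lra.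
have [_ -> _] := turn_liftP If (iter m f z) (turns I f m z a).
by rewrite subrr addr0.
Qed.

Lemma has_angleZ (r : R) a w : 0 < r -> has_angle a w -> has_angle a (r *: w).
Proof. by move=> r0 [s s0 ->]; exists (r * s); rewrite ?mulr_gt0 ?scalerA. Qed.

(** At time [u] in [[k, k + 1]], the chain rule writes the differential of the
    extended isotopy as that of [I (u - k)] at the [k]-th iterate, applied to the
    image of [w] under the [k]-th iterate. *)
Lemma int_dtheta_DI n z w a : has_angle a w ->
  int_dtheta (DI I n z w) = turns I f n z a - a.
Proof.
move=> [r r0 we].
have I1 : I 1 = f by have [_ _ _ _ ?] := If.
have E1 : turns_lift n.+1 z a (n%:R * 1) = turns I f n z a.
  rewrite mulr1 (@turns_lift_at n) ?lexx ?ler_nat //= subrr.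
  by have [_ -> _] := turn_liftP If (iter n f z) (turns I f n z a).
have E0 : turns_lift n.+1 z a (n%:R * 0) = a.
  rewrite mulr0 (@turns_lift_at 0) ?lexx ?ler01 //= subr0.
  by have [_ -> _] := turn_liftP If z a.
have nn : continuous (fun t : R => n%:R * t).
  by move=> t; apply: cvgM; [exact: cvg_cst|exact: cvg_id].
(* One summand more than the [n] iterations, because the time [u = n] reached at [t = 1]
   belongs to the interval that starts at [n]. *)
rewrite (@int_dthetaE _ (fun t => turns_lift n.+1 z a (n%:R * t))).
- by rewrite E1 E0.
- exact: (continuousT_comp nn (@continuous_turns_lift n.+1 z a)).
move=> t tI; have /andP[t0 t1] : 0 <= t <= 1 by move: tI; rewrite in_itv.
rewrite /DI [(_, _).2]/snd.
set u := n%:R * t; set k := Num.truncn u.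
have u0 : 0 <= u by rewrite mulr_ge0.
have un : u <= n%:R by rewrite ler_piMr.
have ku : k%:R <= u by have := truncn_le u; rewrite u0.
have uk : u < k.+1%:R by exact: truncnS_gt.
have kn : (k < n.+1)%N by rewrite ltnS -(ler_nat R) (le_trans ku).
rewrite (turns_lift_at _ _ kn); last by rewrite ku ltW.
have uI : u - k%:R \in `[0, 1] by rewrite in_itv /=; move: uk; rewrite -natr1 => ?; apply/andP; split; lra.
rewrite /extend_isotopy -/u -/k I1 annulus_d_comp; last 2 first.
- by have [h _ _ _ _] := If; exact/annulus_diffeo1_diff_lift/h.
- exact/has_diff_lift_iter/annulus_diffeo1_diff_lift/(isotopy_end_diffeo If).
rewrite we annulus_dZ annulus_dZ; apply: has_angleZ => //.
have [s s0 ->] := has_angle_turns If k z a.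
rewrite annulus_dZ; apply: has_angleZ => //.
have [_ _ h] := turn_liftP If (iter k f z) (turns I f k z a).
by have := h _ uI; rewrite /dI clamp_id.
Qed.

End torsion.

(** * The measure of open sets, and the frequency of visits *)

Section annulus_measure.
Context {R : realType}.

Definition arc (a b : R) : set (circle R) := circle_pi @` `]a, b[%classic.
Definition box (a b c d : R) : set (annulus R) := arc a b `*` `]c, d[%classic.

(** Arcs are open, because the projection to the circle is an open map. *)
Lemma measurable_arc a b : measurable (arc a b).
Proof.
suff : measurable (circle_pi @^-1` (arc a b)) by [].
apply: open_measurable; apply/open_circleP; apply: open_circle_image.
exact: interval_open.
Qed.

Lemma measurable_box a b c d : measurable (box a b c d).
Proof. by apply: measurableX; [exact: measurable_arc|exact: measurable_itv]. Qed.

Lemma open_annulus_box (A : set (annulus R)) (p : plane R) : open A -> A (annulus_pi p) ->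
  exists2 e : R, 0 < e & box (p.1 - e) (p.1 + e) (p.2 - e) (p.2 + e) `<=` A.
Proof.
move=> oA Ap.
have : nbhs p (annulus_pi @^-1` A).
  by apply: continuous_annulus_pi; exact: open_nbhs_nbhs.
case: p Ap => x y Ap [[B1 B2] /= [/nbhs_ballP[e1 /= e10 h1] /nbhs_ballP[e2 /= e20 h2]] h].
pose m := Num.min e1 e2.
have m0 : 0 < m by rewrite lt_min e10.
have m1 : m <= e1 by rewrite ge_min lexx.
have m2 : m <= e2 by rewrite ge_min lexx orbT.
exists m => // -[c v] [/= [u uI <-] vI].
have : (B1 `*` B2) (u, v).
  move: uI vI; rewrite /= !in_itv /= => /andP[u1 u2] /andP[v1 v2]; split.
    by apply: h1; rewrite /ball /= ltr_norml; apply/andP; split; lra.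
  by apply: h2; rewrite /ball /= ltr_norml; apply/andP; split; lra.
by move/h.
Qed.

(** An open set is the countable union of the boxes with rational ends that it
    contains. *)
Lemma open_measurable_annulus (A : set (annulus R)) : open A -> measurable A.
Proof.
move=> oA.
pose rbox (q : (rat * rat) * (rat * rat)) := box (ratr q.1.1) (ratr q.1.2) (ratr q.2.1) (ratr q.2.2).
pose F q := if `[< rbox q `<=` A >] then rbox q else set0.
have -> : A = \bigcup_q F q.
  apply/seteqP; split=> [z Az|z [q _]]; last first.
    by rewrite /F; case: asboolP => // s /s.
  rewrite -(annulus_reprK z) in Az *; set p := annulus_repr z in Az *.
  have [e e0 h] := open_annulus_box oA Az.
  have lt1 : p.1 - e < p.1 by rewrite gtrBl.
  have lt2 : p.1 < p.1 + e by rewrite ltrDl.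
  have lt3 : p.2 - e < p.2 by rewrite gtrBl.
  have lt4 : p.2 < p.2 + e by rewrite ltrDl.
  have [a aI] := rat_in_itvoo lt1; have [b bI] := rat_in_itvoo lt2.
  have [c cI] := rat_in_itvoo lt3; have [d dI] := rat_in_itvoo lt4.
  move: aI bI cI dI; rewrite !in_itv /= => /andP[a1 a2] /andP[b1 b2] /andP[c1 c2] /andP[d1 d2].
  exists ((a, b), (c, d)) => //; rewrite /F; case: asboolP => [_|].
    split=> /=; last by rewrite in_itv /= c2.
    by exists p.1 => //=; rewrite in_itv /= a2.
  case=> -[u v] [/= [u' u'I <-] vI]; apply: h; move: u'I vI.
  rewrite /rbox /= !in_itv /= => /andP[h1 h2] /andP[h3 h4].
  split=> /=; last by rewrite in_itv /=; apply/andP; split; lra.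
  by exists u' => //=; rewrite in_itv /=; apply/andP; split; lra.
apply: countable_bigcupT_measurable => // q.
by rewrite /F; case: ifP => _ //; exact: measurable_box.
Qed.

(** The point above [z] is taken with [0 <= x < 1], so that the arc issued from [x] to
    the right contains an interval of the fundamental domain [[0, 1[]. *)
Lemma Leb_open_gt0 (A : set (annulus R)) : open A -> A !=set0 -> (0 < Leb A)%E.
Proof.
move=> oA [z Az].
pose x := (annulus_repr z).1 - (Num.floor (annulus_repr z).1)%:~R.
pose p : plane R := (x, (annulus_repr z).2).
have pz : annulus_pi p = z.
  rewrite -[RHS]annulus_reprK; apply/annulus_piP; split=> //=.
  by rewrite /x addrAC subrr add0r rpredN intr_int.
have /andP[x0 x1] : 0 <= x < 1.
  by have := floor_itv (annulus_repr z).1; rewrite intrD => /andP[? ?]; apply/andP; split; rewrite /x; lra.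
rewrite -pz in Az; have [e e0 h] := open_annulus_box oA Az.
have mb := measurable_box (p.1 - e) (p.1 + e) (p.2 - e) (p.2 + e).
apply: (@lt_le_trans _ _ (Leb (box (p.1 - e) (p.1 + e) (p.2 - e) (p.2 + e)))); last first.
  by apply: le_measure; rewrite ?inE //; exact: open_measurable_annulus.
rewrite /Leb /= /box product_measure1E //=; last exact: measurable_arc.
apply: mule_gt0; last first.
  rewrite lebesgue_measure_itv /= lte_fin ifT; last by rewrite ltrD2l gtrN.
  by rewrite -EFinB lte_fin; lra.
pose r := Num.min (x + e) 1.
have xr : x < r by rewrite lt_min x1 andbT ltrDl.
apply: (@lt_le_trans _ _ (@lebesgue_measure R `]x, r[%classic)).
  by rewrite lebesgue_measure_itv /= lte_fin xr -EFinB lte_fin subr_gt0.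
rewrite /circle_lebesgue /pushforward /mrestr.
apply: le_measure; rewrite ?inE //.
  by apply: measurableI => //; exact: measurable_arc.
move=> u /=; rewrite in_itv /= lt_min => /and3P[u1 u2 u3]; split.
  by exists u => //=; rewrite in_itv /= u2 andbT; lra.
by rewrite /= in_itv /= u3 andbT; lra.
Qed.

End annulus_measure.

Section visits.
Context d (T : measurableType d) (R : realType) (mu : {measure set T -> \bar R}).

Definition visits (g : T -> T) (V : set T) n (z : T) : R := \sum_(i < n) \1_V (iter i g z).

Lemma visits_ge0 g V n z : 0 <= visits g V n z.
Proof. by apply: sumr_ge0 => i _; rewrite indicE. Qed.

Lemma visits_le g V n z : visits g V n z <= n%:R.
Proof.
rewrite -[X in _ <= X%:R]card_ord -sumr_const; apply: ler_sum => i _.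
by rewrite indicE; case: (_ \in _); rewrite ?ler01.
Qed.

(** Each visit indicator has integral [mu V] over [U], by invariance, and so has the
    frequency of visits at every time. The frequency is bounded by [1] and [U]
    has finite measure, so dominated convergence applies. *)
Lemma visits_density0 (g : T -> T) (U V : set T) :
  measurable U -> (mu U < +oo)%E -> V `<=` U -> g @^-1` U = U ->
  (forall n, measurable (iter n g @^-1` V)) ->
  (forall n, mu (iter n g @^-1` V) = mu V) ->
  {ae mu, forall z, U z -> visits g V n.+1 z / n.+1%:R @[n --> \oo] --> (0 : R)} ->
  mu V = 0%E.
Proof.
move=> mU fU VU gU mV muV ae0.
pose f n z := (visits g V n.+1 z / n.+1%:R)%:E : \bar R.
pose V_ i := iter i g @^-1` V.
have fE n : f n = fun z => ((n.+1%:R^-1)%:E * \sum_(i < n.+1) (\1_(V_ i) z)%:E)%E.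
  by apply/funext => z; rewrite /f mulrC EFinM sumEFin.
have VU_ i : V_ i `<=` U.
  have -> : U = iter i g @^-1` U.
    elim: i => [//|i IH]; rewrite -[in LHS]gU [in LHS]IH.
    by apply/seteqP; split=> z /=; rewrite -iterSr.
  by move=> z /VU.
have mi i : measurable_fun U (fun z => (\1_(V_ i) z)%:E : \bar R).
  by apply/measurable_EFinP; apply: measurable_indic; exact: mV.
have ms n : measurable_fun U (fun z => \sum_(i < n.+1) (\1_(V_ i) z)%:E : \bar R)%E.
  by apply: emeasurable_sum => i; exact: mi.
have mf n : measurable_fun U (f n).
  by rewrite fE; apply: measurable_funeM; exact: ms.
have intf n : (\int[mu]_(z in U) f n z = mu V)%E.
  rewrite fE ge0_integralZl_EFin //; last first.
    by move=> z _; apply: sume_ge0 => i _; rewrite lee_fin.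
  rewrite ge0_integral_sum //.
  rewrite (eq_bigr (fun _ => mu V)) => [|i _]; last first.
    by rewrite integral_indic // ?setIidl //; first [exact: muV|exact: mV|exact: VU_].
  have : (mu V <= mu U)%E by apply: le_measure; rewrite ?inE //; exact: (mV 0%N).
  have : (0 <= mu V)%E by exact: measure_ge0.
  case: (mu V) => [r _ _| |].
  - by rewrite sumEFin -EFinM sumr_const card_ord -[r *+ _]mulr_natl mulKf ?pnatr_eq0.
  - by rewrite leye_eq => _ /eqP e; rewrite e in fU.
  - by [].
have [] := @dominated_convergence d T R mu U mU f (cst 0%E) (cst 1%E).
- exact: mf.
- exact: measurable_cst.
- apply: filterS ae0 => z h /h{}h.
  apply: cvg_EFin; first by near=> n.
  exact: h.
- apply/integrableP; split; first exact: measurable_cst.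
  under eq_integral do rewrite /= normr1.
  by rewrite integral_cst // mul1e.
- apply: aeW => z n _; rewrite /f abse_EFin lee_fin ger0_norm ?divr_ge0 ?visits_ge0 //.
  by rewrite ler_pdivrMr // mul1r visits_le.
move=> _ _; rewrite integral0.
have -> : (fun n => \int[mu]_(z in U) f n z)%E = cst (mu V) by apply/funext => n; exact: intf.
move=> h; apply: (cvg_unique _ _ h); first exact: ereal_hausdorff.
exact: cvg_cst.
Unshelve. all: by end_near.
Qed.

End visits.

(** * Torsion and over-conjugate points *)

Section zero_torsion.
Context {R : realType} (I : R -> annulus R -> annulus R) (f : annulus R -> annulus R).
Context (If : isotopy I f) (ft : positive_twist f).
Implicit Types (z : annulus R) (w : plane R).

Lemma turns_le0 n z : turns I f n z 0 <= 0.
Proof.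
elim: n => [|n IH] /=; first exact: lexx.
apply: (le_trans (turn_le If _ IH)).
by have /andP[_ /ltW] := turn_range If (iter n f z) ft.
Qed.

Lemma over_conjugateE z : over_conjugate I z <-> exists n, turns I f n z 0 < - 2^-1.
Proof.
have va : has_angle (0 : R) vertical by rewrite -dir0; exact: has_angle_dir.
split=> [[n _]|[[|n]]]; first by rewrite (int_dtheta_DI If n z va) subr0; exists n.
  by rewrite /= oppr_gt0 invr_lt0 ltrn0.
by move=> h; exists n.+1 => //; rewrite (int_dtheta_DI If _ z va) subr0.
Qed.

(** By monotonicity and commutation with half turns, this reduces to [turns_le0]. *)
Lemma turns_over_conjugate m n z : (n <= m)%N ->
  turns I f n z 0 < - 2^-1 -> turns I f m z 0 < - 2^-1.
Proof.
move=> nm h; rewrite -(subnK nm) turnsD.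
apply: (lt_le_trans (turns_lt If _ _ h)).
have := turnsB_halves If (m - n) 1 (iter n f z) 0.
by rewrite sub0r mul1r => ->; rewrite gerDr turns_le0.
Qed.

(** The angle of [w] is taken in [[0, 1[], between the angles [0] and [1] of the
    vertical; its displacement is then bounded like that of the vertical. *)
Lemma no_over_conjugate_torsion0 z : ~ over_conjugate I z -> asymptotic_torsion I z 0.
Proof.
move=> noc w w0; have [a /andP[a0 a1] wa] := has_angle_exists w0.
have lo n : - 2^-1 <= turns I f n z 0.
  by rewrite leNgt; apply/negP => h; apply: noc; apply/over_conjugateE; exists n.
have bd n : `|int_dtheta (DI I n z w)| <= 2.
  rewrite (int_dtheta_DI If n z wa) ler_norml.
  have h1 := turns_le If n z a0; have h2 := turns_le If n z (ltW a1).
  have h3 := lo n; have h4 := turns_le0 n z.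
  have h5 : turns I f n z 1 = turns I f n z 0 + 1.
    have e : 1 = 0 + 2^-1 + 2^-1 :> R by field.
    by rewrite [in LHS]e !(turnsD_half If) -addrA; congr (_ + _); field.
  by apply/andP; split; lra.
apply/cvgrPdist_lt => e e0; near=> n.
rewrite sub0r normrN /Torsion_n normrM.
have n0 : 0 < n%:R :> R by near: n; exact: nbhs_infty_gtr.
have ne : 2 / e < n%:R :> R by near: n; exact: nbhs_infty_gtr.
rewrite gtr0_norm ?invr_gt0 // mulrC ltr_pdivrMr //.
by apply: (le_lt_trans (bd n)); rewrite mulrC -ltr_pdivrMr.
Unshelve. all: by end_near.
Qed.

(** At a visit the next [L] iterations lower the angle by more than a half turn, and
    otherwise they do not raise it, by [turns_le0]; commutation with half turns
    lets these losses accumulate. *)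
Lemma turns_visits L (V : set (annulus R)) k z :
  (forall z, V z -> turns I f L z 0 < - 2^-1) ->
  turns I f (k * L) z 0 <= - (visits R (iter L f) V k z / 2 : R).
Proof.
move=> hV; pose N j := (\sum_(i < j) (iter i (iter L f) z \in V))%N.
have -> : visits R (iter L f) V k z = (N k)%:R :> R by rewrite /visits /N natr_sum.
elim: k => [|k IH]; first by rewrite mul0n /N big_ord0 mul0r oppr0.
rewrite mulSn turnsD.
apply: (le_trans (turns_le If _ _ IH)).
rewrite -[- (_ / 2)]sub0r (turnsB_halves If) /N big_ord_recr /= natrD mulrDl opprD addrC lerD2l.
rewrite iterM; case: (boolP (_ \in V)) => [|_]; last by rewrite mul0r oppr0 turns_le0.
by rewrite inE => /hV/ltW; rewrite mul1r.
Qed.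

Lemma torsion0_visits L (V : set (annulus R)) z :
  (forall z, V z -> turns I f L z 0 < - 2^-1) -> asymptotic_torsion I z 0 ->
  (visits R (iter L f) V n.+1 z / n.+1%:R : R) @[n --> \oo] --> (0 : R).
Proof.
move=> hV tz.
(* For [L = 0] the hypothesis forces [V] to be empty. *)
case: L hV => [|L] hV.
  have -> : (fun n => visits R (iter 0 f) V n.+1 z / n.+1%:R : R) = fun=> 0.
    apply/funext => n; rewrite /visits big1 ?mul0r // => i _; rewrite indicE.
    case: (boolP (_ \in V)) => // ; rewrite inE => /hV /=.
    by rewrite oppr_gt0 invr_lt0 ltrn0.
  exact: cvg_cst.
have va : has_angle (0 : R) vertical by rewrite -dir0; exact: has_angle_dir.
have v0 : vertical != 0 :> plane R by exact: has_angle_neq0 va.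
have L0 : 0 < L.+1%:R :> R by rewrite ltr0n.
apply/cvgrPdist_lt => e e0.
have /cvgrPdist_lt/(_ (e / (2 * L.+1%:R))) := tz _ v0.
rewrite divr_gt0 ?mulr_gt0 // => /(_ isT)[N _ NP].
exists N => // k /= Nk.
have := NP (k.+1 * L.+1)%N; rewrite /= => /(_ (leq_trans Nk _))h.
have {h} := h (leq_trans (leqnSn k) (leq_pmulr _ (ltn0Sn L))).
rewrite !sub0r !normrN /Torsion_n (int_dtheta_DI If _ z va) subr0.
have k0 : 0 < k.+1%:R :> R by rewrite ltr0n.
have := turns_visits k.+1 z hV; set x := turns _ _ _ _ _; set y := visits _ _ _ _ _ => xy.
have y0 : 0 <= y by exact: visits_ge0.
rewrite natrM ler0_norm; last first.
  by rewrite mulr_ge0_le0 ?turns_le0 // invr_ge0 mulr_ge0 ?ltW.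
rewrite ger0_norm ?divr_ge0 ?(ltW k0) //.
rewrite ltr_pdivlMr ?mulr_gt0 // ltr_pdivrMr //.
have -> : - ((k.+1%:R * L.+1%:R)^-1 * x) * (2 * L.+1%:R) = - (2 * x) / k.+1%:R.
  by field; rewrite !gt_eqF.
by rewrite ltr_pdivrMr //; lra.
Qed.

End zero_torsion.

Section periodic.
Context {R : realType} (f : annulus R -> annulus R) (U : set (annulus R)).

(** Periodicity is stated with direct images; injectivity turns it into a statement
    on inverse images. *)
Lemma preimage_iter_periodic n M : injective f -> iter M f @` U = U ->
  iter (n * M) f @^-1` U = U.
Proof.
move=> fI fU.
have h : iter M f @^-1` U = U.
  apply/seteqP; split=> z /=; last by move=> Uz; rewrite -fU; exists z.
  rewrite -{1}fU => -[u Uu] e.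
  have iI : injective (iter M f) by elim: M {fU e} => //= M IH x y /fI/IH.
  by rewrite -(iI _ _ e).
elim: n => [|n IH]; first by [].
have hM x : U (iter M f x) = U x := congr1 (@^~ x) h.
rewrite mulSn; apply/funext => z; rewrite /preimage /= iterD hM.
by rewrite -[in RHS]IH.
Qed.

End periodic.

Theorem proposition1p1 (R : realType) (f : annulus R -> annulus R)
    (I : R -> annulus R -> annulus R) (U : set (annulus R))
    (f_twist : positive_twist f) (f_Leb : preserves_Leb f)
    (If : isotopy I f)
    (U_open : open U) (U_periodic : periodic_set f U)
    (U_finite : (Leb U < +oo)%E) :
  let i := forall z, U z -> asymptotic_torsion I z 0 in
  let ii := {ae Leb, forall z, U z -> asymptotic_torsion I z 0} in
  let iii := forall z, U z -> ~ over_conjugate I z in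
  (i <-> ii) /\ (ii <-> iii).
Proof.
move=> i ii iii.
have iii_i : iii -> i by move=> h z Uz; exact: (no_over_conjugate_torsion0 If f_twist (h z Uz)).
have i_ii : i -> ii by move=> h; apply: aeW.
suff ii_iii : ii -> iii by split; split => // h; [exact/iii_i/ii_iii|exact/i_ii/iii_i].
move=> ae0 z0 Uz0 /(over_conjugateE If)[n n_oc].
have [M M1 fU] := U_periodic.
have fI : injective f by have [g [gK _ _ _]] := isotopy_end_diffeo If; exact: can_inj gK.
(* A multiple of the period, so that [U] is invariant under [iter L f], and at least [n],
   so that [z0] is still beyond a half turn at time [L]. *)
pose L := (n * M)%N.
pose V := U `&` [set z | turns I f L z 0 < - 2^-1].
have Vz0 : V z0 by split=> //=; apply: (turns_over_conjugate If f_twist _ n_oc); exact: leq_pmulr.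
have hV z : V z -> turns I f L z 0 < - 2^-1 by case.
have oV : open V.
  apply: openI => //; apply: (@open_comp _ _ (fun z => turns I f L z 0) [set x | x < - 2^-1]).
    by move=> z _; apply: (continuous_turns If).
  exact: open_lt.
have oVk k : open (iter k f @^-1` V).
  by apply: open_comp => // z _; apply: (continuous_iter If).
have LV k : Leb (iter k f @^-1` V) = Leb V.
  elim: k => [//|k <-]; rewrite -[RHS]f_Leb; last by apply: open_measurable_annulus; exact: oVk.
  by congr Leb; apply/funext => z; rewrite /preimage /mkset iterSr.
have iL k : iter k (iter L f) = iter (k * L) f by apply/funext => z; rewrite iterM.
have : Leb V = 0%E.
  apply: (@visits_density0 _ _ _ Leb (iter L f) U V) => //.
  - exact: open_measurable_annulus.
  - by move=> z [].
  - exact: preimage_iter_periodic.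
  - by move=> k; rewrite iL; apply: open_measurable_annulus; exact: oVk.
  - by move=> k; rewrite iL; exact: LV.
  - by apply: filterS ae0 => z h /h; exact: (torsion0_visits If f_twist).
have : (0 < Leb V)%E by apply: Leb_open_gt0 => //; exists z0.
by move=> + e; rewrite e ltxx.
Qed.
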